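(* If $G$ is a graph that does not contain a propeller as an induced subgraph, then $G$ has a node of degree at most 2, and $G$ is 3-colorable.
   Context: All graphs are finite, simple, undirected (and nonempty). A propeller $(C,x)$ is a graph consisting of a chordless cycle $C$ (the rim) and a node $x\notin V(C)$ (the center) that has at least two neighbors on $C$. *)

(* Defs.v *)
From mathcomp Require Import all_boot.
Set Implicit Arguments.
Unset Strict Implicit.
Unset Printing Implicit Defensive.

(* A graph is an edge relation on a finType; it is simple and undirected
   when the relation is symmetric and irreflexive. *)

Definition simple_graph (V : finType) (e : rel V) : Prop :=
  symmetric e /\ irreflexive e.

Definition neighbors (V : finType) (e : rel V) (v : V) : {set V} :=
  [set w | e v w].

Definition degree (V : finType) (e : rel V) (v : V) : nat := #|neighbors e v|.

Definition colorable (k : nat) (V : finType) (e : rel V) : Prop :=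
  exists f : V -> 'I_k, forall u v : V, e u v -> f u != f v.

Definition induced (V : finType) (e : rel V) (S : {set V}) :
    rel {v : V | v \in S} :=
  fun u v => e (val u) (val v).

(* Triangles are allowed: they have no chord. The bound on the size excludes
   the degenerate sequences u :: v :: nil, which ucycle accepts for an edge. *)
Definition chordless_cycle (V : finType) (e : rel V) (c : seq V) : Prop :=
  [/\ 3 <= size c, ucycle e c
    & forall u v : V, u \in c -> v \in c -> e u v ->
        v = next c u \/ u = next c v].

(* The rim c and the center x exhaust the vertex set V. *)
Definition is_propeller (V : finType) (e : rel V) : Prop :=
  exists (c : seq V) (x : V),
    [/\ chordless_cycle e c, x \notin c,
        forall v : V, v = x \/ v \in c
      & 2 <= #|[set v in c | e x v]|].

Definition has_induced_propeller (V : finType) (e : rel V) : Prop :=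
  exists S : {set V}, is_propeller (@induced V e S).

(* Main.v *)
Require Import Defs.
From mathcomp Require Import all_boot zify.
Set Implicit Arguments.
Unset Strict Implicit.
Unset Printing Implicit Defensive.

(** If two nonadjacent neighbours p, q of a vertex x are joined by two anticomplete
    connected sets avoiding x, then x is the center of a propeller. This is the only way in which
    propellers are used outside triangles.

    Key step: let y be a vertex outside a set H such that H + y is triangle-free and H
    contains a cycle through two neighbours of y. Then some edge uv of H separates two
    neighbours a, b of y in H. Take such a cycle with as few chords as possible; it has
    a chord, as y is not the center of a propeller, and a and b lie on different sides of
    every chord. If the chord uv nearest to a does not separate a from b in H, a shortest
    path around it either gives a propeller whose center is u, v or an end of the path, or
    reroutes the cycle so as to lower the number of chords.

    Degree: suppose that all degrees are at least 3. A minimal nonempty set with at most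
    one boundary vertex meets no triangle. Inside it, take a minimal nonempty set Y whose
    boundary is contained in {u, v, w} with u = v or uv an edge. Then w has two neighbours
    in Y, and they lie on a cycle of Y + u + v. The key step for y = w and H = Y + u + v
    gives an edge whose removal leaves a component inside Y, whose boundary is of the same
    kind, contradicting the minimality of Y. The coloring is greedy. *)

(** * Connected sets and shortest connections *)

Section Graph.
Variables (V : finType) (e : rel V).
Hypotheses (eS : symmetric e) (eI : irreflexive e).

(** The key step needs a triangle-free setting, but a propeller-free graph may contain triangles.
    Hence the passage to a minimal set with at most one boundary vertex: a triangle with two corners
    in it would cut off a smaller set of the same sort. That family is too narrow for the second
    descent, since an edge cd that separates two neighbours of w leaves a piece attached to c, d and
    w. Boundaries of the form {u, v, w} are stable under this operation, and u, v being equal or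
    adjacent keeps them from lying on different sides of the cut, so that one side contains neither.
    Minimum degree three enters twice: to leave a triangle at one of its corners, and to show that Y
    is not a single vertex. In the key step only the chords between the two a-b paths of the cycle
    are counted; each path is kept induced, and shortening it inside its own vertex set creates no
    such chord. *)

Definition no_edge (A B : seq V) := forall x z, x \in A -> z \in B -> ~~ e x z.

Definition attached (x : V) (A : seq V) := exists2 z, z \in A & e x z.

(** Lists stand for vertex sets, so that interiors of paths can be used directly; order and
    repetitions do not matter, and the empty list counts as connected. *)
Definition conn (A : seq V) :=
  {in A &, forall x z, connect [rel u v | [&& e u v, u \in A & v \in A]] x z}.

(** Taking [c = d] deletes a single vertex, so one relation serves for cut vertices and for
    separating edges. *)
Definition avoid (H : seq V) (c d : V) : rel V :=
  [rel x z | [&& e x z, x \in [seq w <- H | (w != c) && (w != d)] &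
    z \in [seq w <- H | (w != c) && (w != d)]]].

Lemma conn_cat (A B : seq V) x z :
  conn A -> conn B -> x \in A -> z \in B -> (x == z) || e x z -> conn (A ++ B).
Proof.
move=> cA cB xA zB xz.
set R := [rel u v | [&& e u v, u \in A ++ B & v \in A ++ B]].
have sR : connect_sym R.
  by apply: sym_connect_sym => u v; rewrite /R /= eS [(u \in _) && _]andbC.
have RA : {in A &, forall u v, connect R u v}.
  move=> u v uA vA; apply: connect_sub (cA u v uA vA) => u' v' /= /and3P[e1 i1 i2].
  by apply: connect1; rewrite /= e1 !mem_cat i1 i2.
have RB : {in B &, forall u v, connect R u v}.
  move=> u v uA vA; apply: connect_sub (cB u v uA vA) => u' v' /= /and3P[e1 i1 i2].
  by apply: connect1; rewrite /= e1 !mem_cat i1 i2 !orbT.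
have Rxz : connect R x z.
  case/orP: xz => [/eqP->|xz]; first exact: connect0.
  by apply: connect1; rewrite /= xz !mem_cat xA zB orbT.
have AB u v : u \in A -> v \in B -> connect R u v.
  by move=> uA vB; rewrite (connect_trans (RA _ _ uA xA)) // (connect_trans Rxz) ?RB.
move=> u v; rewrite !mem_cat => /orP[] iu /orP[] iv; try by [apply: RA | apply: RB | apply: AB].
by rewrite -/R sR; apply: AB.
Qed.

Lemma path_conn x l : path e x l -> conn (x :: l).
Proof.
elim: l x => [|y l IH] x /=; first by move=> _ u v; rewrite !inE => /eqP-> /eqP->.
case/andP=> xy /IH cl; apply: (@conn_cat [:: x] (y :: l) x y) => //.
- by move=> u v; rewrite !inE => /eqP-> /eqP->.
- exact: mem_head.
- exact: mem_head.
- by rewrite xy orbT.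
Qed.

Lemma path_conn_tail x l : path e x l -> conn l.
Proof. by case: l => [|y l] //= /andP[_ /path_conn]. Qed.

Lemma conn_path_cat (A : seq V) x l : conn A -> x \in A -> path e x l -> conn (A ++ l).
Proof.
case: l => [|y l] cA xA; first by rewrite cats0.
case/andP=> xy pl; apply: (conn_cat cA (path_conn pl) xA (mem_head y l)).
by rewrite xy orbT.
Qed.

(* Boolean, so that [ex_minnP] provides a shortest connection constructively. *)
Definition linkb (A B M : seq V) n :=
  [exists Q : n.-tuple V, [exists p in A, [exists r in B,
    [&& 0 < n, all (mem M) Q & path e p (rcons Q r)]]]].

Lemma linkbI (A B M : seq V) p r Q :
  p \in A -> r \in B -> Q <> [::] -> {subset Q <= M} -> path e p (rcons Q r) ->
  linkb A B M (size Q).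
Proof.
move=> pA rB Q0 QM pQ; apply/existsP; exists (in_tuple Q).
apply/existsP; exists p; rewrite pA; apply/existsP; exists r; rewrite rB pQ andbT.
by rewrite lt0n size_eq0 /=; apply/andP; split; [apply/eqP | apply/allP].
Qed.

(** Each clause is a shortcut that minimality of [size Q] forbids. The competitor must be nonempty,
    so a vertex of [Q] is excluded from [A] only if something follows it, and from [B] only if
    something precedes it. *)
Lemma shortest_link (A B M : seq V) p0 r0 Q0 :
  p0 \in A -> r0 \in B -> Q0 <> [::] -> {subset Q0 <= M} -> path e p0 (rcons Q0 r0) ->
  exists Q p r, [/\ p \in A, r \in B, {subset Q <= M} & path e p (rcons Q r)] /\
    [/\ Q <> [::], uniq Q & forall L1 x L2, Q = L1 ++ x :: L2 ->
      [/\ (L2 <> [::] -> x \notin A), (L1 <> [::] -> x \notin B),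
          no_edge L1 L2, no_edge A L2 & no_edge L1 B]].
Proof.
move=> p0A r0B Q00 Q0M pQ0; have ex : exists n, linkb A B M n.
  by exists (size Q0); apply: linkbI pQ0.
case: (ex_minnP ex) => n /existsP[Q /existsP[p /andP[pA /existsP[r /andP[rB /and3P[n0 QM pQ]]]]]] min.
have {}min Q' p' r' : p' \in A -> r' \in B -> Q' <> [::] -> {subset Q' <= M} ->
    path e p' (rcons Q' r') -> size Q <= size Q'.
  by move=> ? ? ? ? ?; rewrite size_tuple; apply: min; apply: linkbI; eassumption.
have {}n0 : val Q <> [::] by move=> Qe; rewrite -(size_tuple Q) Qe in n0.
case: Q n0 QM pQ min => Q /= _ Qn0 QM pQ min.
have {}QM : {subset Q <= M} by apply/allP.
exists Q, p, r; split=> //; split=> //.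
  (* If a vertex occurs at positions i < j, dropping the positions i+1 to j leaves a shorter
     nonempty connection. *)
  rewrite -[uniq Q]negbK; apply/negP => /uniqPn => /(_ p) [i [j [ij jQ eqij]]].
  have iQ := ltn_trans ij jQ.
  set x := nth p Q i in eqij.
  have Q1 : take i.+1 Q = rcons (take i Q) x by rewrite -take_nth.
  have Q2 : drop j Q = x :: drop j.+1 Q by rewrite (drop_nth p) // eqij.
  have: size Q <= size (take i.+1 Q ++ drop j.+1 Q).
    apply: (min _ p r) => //.
    - by rewrite Q1; case: (take i Q).
    - by move=> z; rewrite mem_cat => /orP[/mem_take|/mem_drop]; apply: QM.
    - move: (pQ); rewrite -{1}(cat_take_drop i.+1 Q) rcons_cat cat_path => /andP[pa _].
      rewrite rcons_cat cat_path pa /= Q1 last_rcons.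
      move: pQ; rewrite -{1}(cat_take_drop j Q) Q2 rcons_cat cat_path /= => /andP[_ /andP[]] //.
  by rewrite size_cat size_takel // size_drop; move: jQ; set k := size Q; clearbody k; lia.
move=> L1 x L2 QE; move: pQ; rewrite QE rcons_cat cat_path /= => /and3P[pL1 eL1 pL2].
have sL1 : {subset L1 <= M} by move=> z zL; apply: QM; rewrite QE mem_cat zL.
have sL2 : {subset L2 <= M} by move=> z zL; apply: QM; rewrite QE mem_cat inE zL !orbT.
split.
- move=> L20; apply/negP => xA.
  by have := min _ _ _ xA rB L20 sL2 pL2; rewrite QE size_cat /=; lia.
- move=> L10; apply/negP => xB.
  have := min _ _ _ pA xB L10 sL1; rewrite rcons_path pL1 eL1 QE size_cat /=; lia.
- move=> w z wL zL; apply/negP => wz; case/splitPr: wL QE pL1 sL1 => l1 l1' QE pL1 sL1.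
  case/splitPr: zL QE pL2 sL2 => l2 l2' QE pL2 sL2.
  have := min (l1 ++ w :: z :: l2') p r pA rB; rewrite QE !size_cat /= !size_cat /=.
  move=> H.
  suff: size l1 + (size l2').+2 >= size l1 + (size l1').+1 + (size l2 + (size l2').+1).+1 by clear; lia.
  apply: H.
  + by case: l1 {QE pL1 sL1}.
  + move=> t; rewrite mem_cat !inE => /or3P[tl|/eqP->|/orP[/eqP->|tl]].
    * by apply: sL1; rewrite mem_cat tl.
    * by apply: sL1; rewrite mem_cat mem_head orbT.
    * by apply: sL2; rewrite mem_cat mem_head orbT.
    * by apply: sL2; rewrite mem_cat inE tl !orbT.
  + move: pL1 pL2; rewrite !rcons_cat !cat_path /= wz => /and3P[-> -> _] /= /and3P[_ _ ->] //.
- move=> w z wA zL; apply/negP => wz; case/splitPr: zL QE pL2 sL2 => l2 l2' QE pL2 sL2.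
  have := min (z :: l2') w r wA rB; rewrite QE !size_cat /= !size_cat /=.
  move=> H; suff : size L1 + (size l2 + (size l2').+1).+1 <= (size l2').+1 by clear; lia.
  apply: H => //.
  + by move=> t tl; apply: sL2; rewrite mem_cat tl orbT.
  + by move: pL2; rewrite rcons_cat cat_path /= wz => /and3P[].
- move=> w z wL zB; apply/negP => wz; case/splitPr: wL QE pL1 sL1 => l1 l1' QE pL1 sL1.
  have := min (rcons l1 w) p z pA zB; rewrite QE !size_cat /= ?size_cat ?size_rcons /=.
  move=> H; suff : size l1 + (size l1').+1 + (size L2).+1 <= (size l1).+1 by clear; lia.
  apply: H => //.
  + by case: l1 {QE pL1 sL1}.
  + by move=> t; rewrite mem_rcons inE => tl; apply: sL1; rewrite mem_cat inE; case/orP: tl => ->; rewrite ?orbT.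
  + by move: pL1; rewrite cat_path !rcons_path last_rcons wz andbT /= => /and3P[-> ->].
Qed.

End Graph.

(** * Propellers from connected sets *)

Section Propeller.
Variables (V : finType) (e : rel V).
Hypotheses (eS : symmetric e) (eI : irreflexive e).
Hypothesis free : ~ has_induced_propeller e.

Lemma in_split (x : V) s : x \in s -> exists l1 l2, s = l1 ++ x :: l2.
Proof. by case/splitPr=> l1 l2; exists l1, l2. Qed.

Lemma next_cat (c l1 l2 : seq V) u w :
  uniq c -> c = l1 ++ u :: w :: l2 -> next c u = w.
Proof.
move=> + cE; rewrite cE cat_uniq => /and3P[_ /hasPn/(_ u) + _].
rewrite mem_head next_nth mem_cat mem_head orbT => /(_ isT).
case: l1 {cE} => [|y l1] /=; first by rewrite eqxx.
rewrite inE negb_or eq_sym => /andP[/negPf-> ul1].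
by rewrite index_cat (negPf ul1) /= eqxx addn0 nth_cat ltnNge leqnSn /= subSnn.
Qed.

(** Propellers are defined on the subtype of a vertex set; this version lets rims be written as
    lists over [V]. The set [S] is the rim plus the center, so the default value of [insubd] is
    never reached. *)
Lemma free_seq c x p q : chordless_cycle e c -> x \notin c -> p \in c -> q \in c ->
  p != q -> e x p -> e x q -> False.
Proof.
move=> [c3 /andP[cc cu] cch] xc pc qc pq xp xq; apply: free.
pose S := [set z in x :: c]; exists S.
have xS : x \in S by rewrite inE mem_head.
have cS z : z \in c -> z \in S by rewrite !inE orbC => ->.
pose f z : {v | v \in S} := insubd (exist _ x xS) z.
have fK z : z \in S -> val (f z) = z by move=> zS; rewrite /f val_insubd zS.
pose c' := map f c.
have c'E : c = map val c'.
  rewrite -map_comp -[LHS]map_id; apply/eq_in_map => z zc /=.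
  by rewrite fK // cS.
have vI : injective (val : {v | v \in S} -> V) := val_inj.
have uc' : uniq c' by rewrite -(map_inj_uniq vI) -c'E.
have inc' z : (z \in c') = (val z \in c) by rewrite c'E mem_map.
exists c', (f x); split.
- split; first by rewrite size_map.
  + apply/andP; split=> //.
    by move: cc; rewrite c'E cycle_map.
  + move=> u v; rewrite !inc' => uc vc uv; move: (cch _ _ uc vc uv).
    rewrite c'E !next_map // => -[/vI|/vI]; tauto.
- by rewrite inc' fK.
- move=> v; case: (boolP (v \in c')) => [|vc]; [by right | left].
  apply: vI; rewrite fK //; move: (valP v) vc; rewrite inc' !inE => /orP[/eqP //|->] //.
- have sp : f p \in [set v in c' | @induced V e S (f x) v].
    by rewrite inE inc' /induced /= (fK x xS) (fK p (cS _ pc)); apply/andP.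
  have sq : f q \in [set v in c' | @induced V e S (f x) v].
    by rewrite inE inc' /induced /= (fK x xS) (fK q (cS _ qc)); apply/andP.
  have fpq : f p != f q by rewrite -(inj_eq vI) /= (fK p (cS _ pc)) (fK q (cS _ qc)).
  rewrite (leq_trans _ (subset_leq_card (_ : [set f p; f q] \subset _))) ?cards2 ?fpq //.
  by apply/subsetP => z; rewrite !inE => /orP[]/eqP->; move: sp sq; rewrite !inE.
Qed.

(** An induced path with nonempty interior [t], except that its ends may be adjacent: the exception
    lets the same notion produce a rim through an edge of a triangle. *)
Definition ipath p t q :=
  [/\ path e p (rcons t q), uniq (p :: rcons t q), t <> [::] &
   forall L1 x L2, p :: rcons t q = L1 ++ x :: L2 ->
   forall w z, w \in L1 -> z \in L2 -> e w z -> w = p /\ z = q].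

Lemma ipath_consec p t q u w : ipath p t q -> ~~ e p q ->
  u \in p :: rcons t q -> w \in p :: rcons t q -> e u w ->
  exists l1 l2, p :: rcons t q = l1 ++ u :: w :: l2 \/ p :: rcons t q = l1 ++ w :: u :: l2.
Proof.
move=> [_ _ _ cut] npq; wlog: u w / exists l1 l2 l3, p :: rcons t q = l1 ++ u :: l2 ++ w :: l3.
  move=> H uP wP uw; have [l1 [l2 E]] := in_split uP.
  move: wP; rewrite E mem_cat inE => /or3P[|/eqP wu|].
  - case/in_split=> m1 [m2 E1]; rewrite -E.
    have [||||l3 [l4 E2]] := H w u; last by exists l3, l4; tauto.
    + by exists m1, m2, l2; rewrite E E1 -catA.
    + by rewrite E E1 !mem_cat mem_head orbT.
    + by [].
    + by rewrite eS.
  - by move: uw; rewrite wu eI.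
  - case/in_split=> m1 [m2 E1]; rewrite -E; apply: H => //.
    + by exists l1, m1, m2; rewrite E E1.
    + by rewrite E E1 mem_cat inE mem_cat mem_head !orbT.
case=> l1 [[|x l2] [l3 E]] uP wP uw; first by exists l1, l3; left.
have [] := cut (l1 ++ [:: u]) x (l2 ++ w :: l3) _ u w; rewrite ?mem_cat ?mem_head ?orbT //.
  by rewrite E -catA.
by move=> up wq; move: npq; rewrite -up -wq uw.
Qed.

Lemma conn_ipath p q A : conn e A -> p \notin A -> q \notin A -> p != q ->
  attached e p A -> attached e q A -> exists2 t, {subset t <= A} & ipath p t q.
Proof.
move=> cA pA qA pq [x xA px] [z zA qz].
have /connectP[l pl lz] := cA x z xA zA.
have lA : {subset x :: l <= A}.
  move=> w; rewrite inE => /orP[/eqP->//|].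
  elim: l x {xA px lz} pl => //= y l IH x /andP[/and3P[_ _ yA] /IH H].
  by rewrite inE => /orP[/eqP->|].
have pxl : path e p (rcons (x :: l) q).
  rewrite /= px rcons_path -lz eS qz andbT /=.
  by apply: sub_path pl => ? ? /= /and3P[].
have [|Q [p' [q' [[/[!inE]/eqP-> /eqP-> QA pQ] [Q0 uQ cut]]]]] :=
  @shortest_link V e [:: p] [:: q] A p q (x :: l) (mem_head _ _) (mem_head _ _) _ lA pxl.
  by [].
exists Q => //; split=> //.
  rewrite /= rcons_uniq uQ mem_rcons inE negb_or pq.
  by rewrite (contra (QA p)) // (contra (QA q)).
move=> [|y L1] x' L2; first by move=> _ w t.
move=> [<- E] w t wL tL wt; split.
- move: wL; rewrite inE => /orP[/eqP//|wL].
  case/lastP: L2 E tL => // L2 b E.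
  move: E; rewrite -rcons_cons -rcons_cat => /rcons_inj[E <-].
  have [_ _ H1 _ H2] := cut _ _ _ E.
  rewrite mem_rcons inE => /orP[/eqP tq|tL].
    by move: (H2 w q wL (mem_head _ _)); rewrite -tq wt.
  by move: (H1 w t wL tL); rewrite wt.
- case/lastP: L2 E tL => // L2 b.
  rewrite -rcons_cons -rcons_cat => /rcons_inj[E <-].
  have [_ _ H1 H3 H2] := cut _ _ _ E.
  rewrite mem_rcons inE => /orP[/eqP//|tL].
  move: wL; rewrite inE => /orP[/eqP wp|wL].
    by move: (H3 p t (mem_head _ _) tL); rewrite -wp wt.
  by move: (H1 w t wL tL); rewrite wt.
Qed.

(* [p] and [q] lie on a chordless cycle through [A] and [B], whose center is [x]. *)
Lemma no_theta x p q A B a : e x p -> e x q -> p != q -> ~~ e p q ->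
  conn e A -> conn e B -> attached e p A -> attached e q A ->
  attached e p B -> attached e q B -> no_edge e A B ->
  a \in A -> a \notin B -> x \notin A -> x \notin B -> False.
Proof.
move=> xp xq pq npq cA cB pA qA pB qB AB aA aB xA xB.
have nA w : attached e w B -> w \notin A.
  by case=> z zB wz; apply/negP => wA; move: (AB w z wA zB); rewrite wz.
have nB w : attached e w A -> w \notin B.
  by case=> z zA wz; apply/negP => wB; move: (AB z w zA wB); rewrite eS wz.
(* [no_edge] does not exclude common vertices. The walk in [A] from a common vertex [z] to [a] would
   start with an edge between [A] and [B]. *)
have dAB z : z \in A -> z \notin B.
  move=> zA; apply/negP => zB; case: (eqVneq a z) => [az|az]; first by rewrite az zB in aB.
  have /connectP[[|w l] /=] := cA z a zA aA; first by move=> _ E; rewrite E eqxx in az.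
  case/andP=> /and3P[zw _ wA] _ _; by move: (AB w z wA zB); rewrite eS zw.
have [t tA It] := conn_ipath cA (nA p pB) (nA q qB) pq pA qA.
have [s sB Is] := conn_ipath cB (nB p pA) (nB q qA) pq pB qB.
have [[pt ut t0 _] [ps us s0 _]] := (It, Is).
(* Rotating the rim to start at [q] exposes its second half as a reversed copy of [p :: rcons s q],
   so that adjacency on either path translates into [next]. *)
pose c := p :: t ++ q :: rev s.
have cr : rot (size (p :: t)) c = q :: rev s ++ p :: t by rewrite /c -cat_cons rot_size_cat.
have srev : q :: rcons (rev s) p = rev (p :: rcons s q) by rewrite rev_cons rev_rcons.
have uc : uniq c.
  move: (ut) (us); rewrite /= !mem_rcons !inE !negb_or !rcons_uniq.
  move=> /and3P[/andP[_ pt'] qt ut'] /and3P[/andP[_ ps'] qs us'].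
  rewrite /c /= cat_uniq /= mem_cat inE !mem_rev !negb_or pt' pq ps' ut' rev_uniq us' qs qt /= andbT.
  apply/hasPn => z; rewrite mem_rev => /sB zB; apply/negP => /tA zA.
  by move: (dAB z zA); rewrite zB.
apply: (@free_seq c x p q) => //.
- split.
  + rewrite /c /= size_cat /= size_rev.
    have t1 : 0 < size t by rewrite lt0n size_eq0; apply/eqP.
    by rewrite addnS !ltnS addn_gt0 t1.
  + apply/andP; split=> //; rewrite /c /= rcons_cat rcons_cons -cat_rcons cat_path pt last_rcons /=.
    have := rev_path e p (rcons s q); rewrite last_rcons belast_rcons rev_cons => ->.
    by rewrite (eq_path (e' := e)) // => z w; rewrite eS.
  + have onT u w : u \in p :: rcons t q -> w \in p :: rcons t q -> e u w ->
      w = next c u \/ u = next c w.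
      move=> uP wP uw; have [l1 [l2 E]] := ipath_consec It npq uP wP uw.
      have cE : c = (p :: rcons t q) ++ rev s by rewrite /c /= cat_rcons.
      by case: E => E; [left|right]; apply/esym/(@next_cat c l1 (l2 ++ rev s)) => //; rewrite cE E -catA.
    have onS u w : u \in p :: rcons s q -> w \in p :: rcons s q -> e u w ->
      w = next c u \/ u = next c w.
      move=> uP wP uw; have [l1 [l2 E]] := ipath_consec Is npq uP wP uw.
      have cE : rot (size (p :: t)) c = rev (p :: rcons s q) ++ t by rewrite cr -srev /= cat_rcons.
      rewrite -(next_rot (size (p :: t)) uc) -(next_rot (size (p :: t)) uc w).
      have ur : uniq (rot (size (p :: t)) c) by rewrite rot_uniq.
      case: E => E; [right|left]; apply/esym/(next_cat (l1 := rev l2) (l2 := rev l1 ++ t) ur);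
        rewrite cE E; by rewrite rev_cat !rev_cons -!cats1 -!catA.
    move=> u w uc' wc' uw.
    have inc z : z \in c -> [\/ (z \in p :: rcons t q) && (z \in p :: rcons s q), z \in t | z \in s].
      rewrite /c inE mem_cat inE mem_rev !inE !mem_rcons !inE.
      case/or4P=> [->|H|->|H]; [by constructor 1|by constructor 2|by constructor 1; rewrite !orbT|by constructor 3].
    have st z : z \in t -> z \in p :: rcons t q by rewrite inE mem_rcons inE => ->; rewrite !orbT.
    have ss z : z \in s -> z \in p :: rcons s q by rewrite inE mem_rcons inE => ->; rewrite !orbT.
    case: (inc u uc') => [/andP[u1 u2]|u1|u2]; case: (inc w wc') => [/andP[w1 w2]|w1|w2];
      try by [apply: onT; auto | apply: onS; auto].
    * by move: (AB u w (tA _ u1) (sB _ w2)); rewrite uw.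
    * by move: (AB w u (tA _ w1) (sB _ u2)); rewrite eS uw.
- rewrite /c inE mem_cat inE mem_rev; apply/negP => /or4P[/eqP xE|/tA H|/eqP xE|/sB H].
  + by rewrite xE eI in xp.
  + by rewrite H in xA.
  + by rewrite xE eI in xq.
  + by rewrite H in xB.
- exact: mem_head.
- by rewrite /c inE mem_cat mem_head !orbT.
Qed.

(** The rim is an induced path from [p] to [q] through [A] closed by the edge [pq], the one chord
    that [ipath] tolerates; the third corner [x] of the triangle is the center. *)
Lemma no_triangle_path x p q A : e x p -> e x q -> e p q ->
  conn e A -> attached e p A -> attached e q A ->
  x \notin A -> p \notin A -> q \notin A -> False.
Proof.
move=> xp xq pq cA pA qA xA pnA qnA.
have npq : p != q by apply/eqP => E; rewrite E eI in pq.
have [t tA [pt ut t0 ct]] := conn_ipath cA pnA qnA npq pA qA.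
pose c := p :: rcons t q.
have cr : rot (size (p :: t)) c = q :: p :: t by rewrite /c -rcons_cons -cats1 rot_size_cat.
apply: (@free_seq c x p q) => //.
- split.
  + by rewrite /c /= size_rcons; case: t t0 {tA pt ut ct c cr}.
  + by apply/andP; split=> //; rewrite /c /= rcons_path pt last_rcons eS.
  + have nqp : p = next c q.
      rewrite -(next_rot (size (p :: t)) ut) (@next_cat _ [::] t q p) //.
      by rewrite -/c rot_uniq.
    have key u w l1 l2 l3 : c = l1 ++ u :: l2 ++ w :: l3 -> e u w -> w = next c u \/ u = next c w.
      case: l2 => [|y l2] cE uw; first by left; rewrite (@next_cat c l1 l3 u w).
      have [] := ct (l1 ++ [:: u]) y (l2 ++ w :: l3) _ u w; rewrite ?mem_cat ?mem_head ?orbT //.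
        by rewrite -/c cE -catA.
      by move=> -> ->; right.
    move=> u w uc; have [l1 [l2 E]] := in_split uc; rewrite {1}E mem_cat inE => /or3P[||].
    * case/in_split=> m1 [m2 E1]; rewrite eS => wu.
      by have [|E2|E2] := @key w u m1 m2 l2 _ wu; [rewrite E E1 -catA | right | left].
    * by move/eqP->; rewrite eI.
    * by case/in_split=> m1 [m2 E1] uw; apply: (@key u w l1 m1 m2); rewrite ?E ?E1.
- rewrite /c inE mem_rcons inE; apply/negP => /or3P[/eqP xE|/eqP xE|/tA H].
  + by rewrite xE eI in xp.
  + by rewrite xE eI in xq.
  + by rewrite H in xA.
- exact: mem_head.
- by rewrite /c inE mem_rcons mem_head !orbT.
Qed.

End Propeller.

(** * Chords of a cycle *)

Section Tools.
Variables (V : finType) (e : rel V).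
Hypotheses (eS : symmetric e) (eI : irreflexive e).

Definition disj (A B : seq V) := forall x, x \in A -> x \in B -> False.

Lemma sorted_cat_cons l1 x l2 :
  sorted e (l1 ++ x :: l2) = sorted e (rcons l1 x) && path e x l2.
Proof. by case: l1 => [|z l1] //=; rewrite cat_path rcons_path /= andbA. Qed.

Lemma walk_conn p B q : path e p (rcons B q) -> B <> [::] ->
  [/\ conn e B, attached e p B & attached e q B].
Proof.
case: B => // z B /=; rewrite rcons_path => /and3P[pz pB lq] _; split.
- exact: path_conn.
- by exists z; rewrite ?mem_head.
- by exists (last z B); rewrite ?mem_last // eS.
Qed.

Lemma ipath_sep a t b L1 x L2 : ipath e a t b -> ~~ e a b ->
  a :: rcons t b = L1 ++ x :: L2 -> no_edge e L1 L2 /\ disj L1 L2.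
Proof.
move=> [_ u _ c] ab E; split.
  move=> w z wL zL; apply/negP => wz.
  by have [wa zb] := c _ _ _ E w z wL zL wz; rewrite wa zb (negPf ab) in wz.
move=> w wL wL2; move: u; rewrite E cat_uniq => /and3P[_ /hasPn/(_ w)].
by rewrite inE wL2 orbT wL => /(_ isT).
Qed.

(* Each chord between [t] and [s] is counted in both orientations, which makes the
   definition symmetric in [t] and [s]. *)
Definition cross (t s : seq V) : {set V * V} :=
  [set xz | e xz.1 xz.2 && ((xz.1 \in t) && (xz.2 \in s) || (xz.1 \in s) && (xz.2 \in t))].

Lemma crossC t s : cross s t = cross t s.
Proof. by apply/setP => xz; rewrite !inE orbC. Qed.

Lemma cross_flip t s x z : ((x, z) \in cross t s) = ((z, x) \in cross t s).
Proof. by rewrite !inE /= eS orbC ![(x \in _) && _]andbC. Qed.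

Lemma cross_lt1 t s t' s' u v :
  (forall x z, x \in t' -> z \in s' -> e x z -> (x, z) \in cross t s) ->
  (u, v) \in cross t s -> (u, v) \notin cross t' s' -> #|cross t' s'| < #|cross t s|.
Proof.
move=> sub uv uv'; apply: proper_card; apply/properP; split; last by exists (u, v).
apply/subsetP => -[x z]; rewrite inE /= => /andP[xz] /orP[]/andP[xt zs]; first exact: sub.
by rewrite cross_flip; apply: sub; rewrite // eS.
Qed.

(** Two vanishing chords outweigh one new chord [mn]: four oriented pairs are lost and at most two
    gained. The conditions on [f] make the chords [uv] and [fg] distinct. *)
Lemma cross_lt2 t s t' s' u v f g m n :
  (forall x z, x \in t' -> z \in s' -> e x z -> (x, z) \in cross t s \/ x = m /\ z = n) ->
  (u, v) \in cross t s -> (f, g) \in cross t s ->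
  (u, v) \notin cross t' s' -> (f, g) \notin cross t' s' -> f != u -> f != v ->
  #|cross t' s'| < #|cross t s|.
Proof.
move=> sub uv fg uv' fg' fu fv.
have ne x z : (x, z) \in cross t s -> x != z.
  by rewrite inE /= => /andP[xz _]; apply/eqP => E; rewrite E eI in xz.
pose D := [set (u, v); (v, u); (f, g); (g, f)].
have D4 : #|D| = 4.
  rewrite /D -!setUA !cardsU1 cards1 !inE !xpair_eqE.
  rewrite (negPf (ne _ _ uv)) (negPf (ne _ _ fg)) ![_ == f]eq_sym (negPf fu) (negPf fv).
  by rewrite !(andbF, andFb, orbF).
have Dsub : D \subset cross t s.
  apply/subsetP => w wD; have : [|| w == (u, v), w == (v, u), w == (f, g) | w == (g, f)].
    by move: wD; rewrite /D !in_setU !in_set1 -!orbA.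
  by case/or4P=> /eqP->; rewrite // cross_flip.
have sub2 : cross t' s' \subset (cross t s :\: D) :|: [set (m, n); (n, m)].
  apply/subsetP => -[x z] xz.
  have xD : (x, z) \notin D.
    apply/negP; rewrite !inE -!orbA => /or4P[]/eqP E; rewrite E in xz.
    - by rewrite xz in uv'.
    - by rewrite cross_flip xz in uv'.
    - by rewrite xz in fg'.
    - by rewrite cross_flip xz in fg'.
  rewrite in_setU in_setD xD /=; move: xz; rewrite inE /= => /andP[xz] /orP[]/andP[xt zs].
    by case: (sub x z xt zs xz) => [->//|[-> ->]]; rewrite !inE eqxx !orbT.
  have zx : e z x by rewrite eS.
  case: (sub z x zs xt zx) => [|[-> ->]]; last by rewrite !inE eqxx !orbT.
  by rewrite cross_flip => ->.
have := subset_leq_card sub2; have := cardsD (cross t s) D.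
rewrite (setIidPr Dsub) D4 => cD le1.
have c4 : 4 <= #|cross t s| by rewrite -D4 subset_leq_card.
apply: leq_ltn_trans le1 _; apply: leq_ltn_trans (leq_card_setU _ _) _; rewrite cD.
apply: leq_ltn_trans (_ : _ <= #|cross t s| - 4 + 2) _; first by rewrite leq_add2l cards2; case: (_ != _).
by rewrite -subnA // ltn_subrL /= (leq_trans _ c4).
Qed.

End Tools.

Lemma mem_consr (T : eqType) (x z : T) l : x \in l -> x \in z :: l.
Proof. by rewrite inE => ->; rewrite orbT. Qed.

Lemma mem_catl (T : eqType) (x : T) l1 l2 : x \in l1 -> x \in l1 ++ l2.
Proof. by rewrite mem_cat => ->. Qed.

Lemma mem_catr (T : eqType) (x : T) l1 l2 : x \in l2 -> x \in l1 ++ l2.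
Proof. by rewrite mem_cat => ->; rewrite orbT. Qed.

Lemma mem_rconsl (T : eqType) (x z : T) l : x \in l -> x \in rcons l z.
Proof. by rewrite mem_rcons inE => ->; rewrite orbT. Qed.

Lemma mem_rconsr (T : eqType) (z : T) l : z \in rcons l z.
Proof. by rewrite mem_rcons mem_head. Qed.

Ltac memb := match goal with
  | M : is_true (?x \in ?l) |- is_true (?x \in ?l) => exact M
  | |- is_true (?x \in ?x :: _) => exact (mem_head _ _)
  | |- is_true (?x \in rcons _ ?x) => exact (mem_rconsr _ _)
  | |- is_true (_ \in _ :: _) => simple apply mem_consr; memb
  | |- is_true (_ \in rcons _ _) => simple apply mem_rconsl; memb
  | |- is_true (_ \in _ ++ _) => first [simple apply mem_catl; memb | simple apply mem_catr; memb]
  end.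

(** Most side conditions say that lists glued from pieces of one cycle have no common vertex or no
    edge between them. Once [msplit] has named the pieces, these tactics look for a [disj] or
    [no_edge] fact about larger lists and leave the memberships to [memb]. *)
Ltac clash_edge eS :=
  exfalso;
  match goal with E : is_true (?r ?x ?z), F : no_edge ?r ?A ?B |- _ =>
    solve [ refine (negP (F x z _ _) E); memb
          | refine (negP (F z x _ _) (etrans (eS z x) E)); memb ] end.

Ltac clash_mem :=
  exfalso;
  match goal with M : is_true (?x \in _), F : disj ?A ?B |- _ =>
    solve [ refine (F x _ _); memb ] end.

Ltac msplit M := match type of M with
  | is_true (_ || _) => case/orP: M => M; msplit M
  | is_true (_ \in _ :: _) => rewrite inE in M; msplit M
  | is_true (_ \in [::]) => by []
  | is_true (_ \in _ ++ _) => rewrite mem_cat in M; msplit M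
  | is_true (_ \in rcons _ _) => rewrite mem_rcons in M; msplit M
  | is_true (?x == _) => move/eqP: M => M; subst x
  | _ => idtac end.

(** * Uniqueness of a neighbour on an induced path *)

Section Center.
Variables (V : finType) (e : rel V).
Hypotheses (eS : symmetric e) (eI : irreflexive e).
Hypothesis free : ~ has_induced_propeller e.
Variables (y : V) (H : seq V).
Hypothesis yH : y \notin H.
Hypothesis triangle_free : forall x z w,
  x \in y :: H -> z \in y :: H -> w \in y :: H -> e x z -> e z w -> e x w -> False.

(** The vertex [y] closes the path to a cycle. Two neighbours [p], [q] of [z] are nonadjacent for
    lack of triangles, and they are joined by the segment between them and by the way around through
    [b], [y] and [a]. As [y] sees only the ends of the path, these two are anticomplete and [z]
    would be a center. *)
Lemma one_neighbor a t b z p q : ipath e a t b -> ~~ e a b -> e y a -> e y b ->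
  (forall w, w \in t -> ~~ e y w) -> {subset a :: rcons t b <= H} -> z \in H ->
  z \notin a :: rcons t b -> p \in a :: rcons t b -> q \in a :: rcons t b ->
  e z p -> e z q -> p = q.
Proof.
move=> It ab ya yb yt PH zH zP pP qP zp zq; apply/eqP; case: (eqVneq p q) => // pq; exfalso.
wlog [l1 [l2 [l3 E]]] : p q pP qP zp zq pq / exists l1 l2 l3, a :: rcons t b = l1 ++ p :: l2 ++ q :: l3.
  move=> W; have [l1 [l2 E]] := in_split pP; move: (qP); rewrite E mem_cat inE => /or3P[||].
  - case/in_split=> m1 [m2 E1]; apply: (W q p) => //; first by rewrite eq_sym.
    by exists m1, m2, l2; rewrite E E1 -catA.
  - by rewrite eq_sym (negPf pq).
  - by case/in_split=> m1 [m2 E1]; apply: (W p q) => //; exists l1, m1, m2; rewrite E E1.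
have [pt ut _ _] := It.
have npq : ~~ e p q.
  by apply/negP => epq; apply: (@triangle_free z p q); rewrite ?inE ?zH ?(PH p) ?(PH q) ?orbT.
have [N1 D1] := ipath_sep It ab E.
have [N2 D2] := @ipath_sep _ _ _ _ _ (l1 ++ p :: l2) q l3 It ab (etrans E (catA _ (p :: l2) _)).
have := pt; rewrite -[path e a _]/(sorted e (a :: _)) E sorted_cat_cons cat_path /=.
case/and4P=> sl1 pl2 l2q pl3.
have l20 : l2 <> [::] by move=> l20; move: npq l2q; rewrite l20 /= => /negPf->.
have [cl2 al2 bl2] : [/\ conn e l2, attached e p l2 & attached e q l2].
  by apply: walk_conn => //; rewrite rcons_path pl2.
have lb : last q l3 = b.
  by have := congr1 (last a) E; rewrite /= last_rcons last_cat /= last_cat.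
have ya1 : path e y (rcons l1 p).
  by case: l1 E sl1 {N1 D1 N2 D2} => [|c l1] [<- _] /=; rewrite ya.
have ain : a \in rcons l1 p.
  by case: l1 E {N1 D1 N2 D2 sl1 ya1} => [|c l1] [<- _]; rewrite mem_head.
have bin : b \in q :: l3 by rewrite -lb mem_last.
have [cB aB bB] : [/\ conn e (l3 ++ y :: l1), attached e q (l3 ++ y :: l1)
    & attached e p (l3 ++ y :: l1)].
  by apply: (walk_conn eS); [rewrite rcons_cat cat_path pl3 lb /= eS yb | case: (l3)].
have inP w : w \in l2 -> w \in a :: rcons t b by move=> wl; rewrite E; memb.
have Nab w : w \in l2 -> w != a /\ w != b.
  move: ut; rewrite E -cat_rcons catA cat_uniq => /and3P[+ /hasPn d2 _].
  rewrite cat_uniq => /and3P[_ /hasPn d1 _] wl; split; apply/eqP => wE.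
    by move: (d1 w wl); rewrite wE ain.
  by move: (d2 b bin); rewrite -wE mem_cat wl orbT.
have yl2 : no_edge e [:: y] l2.
  move=> w x; rewrite inE => /eqP-> xl; apply: yt.
  have [xa xb] := Nab x xl; move: (inP x xl); rewrite inE mem_rcons inE.
  by rewrite (negPf xa) (negPf xb).
case: l2 l20 {Nab} E cl2 al2 bl2 inP yl2 N1 D1 N2 D2 pl2 l2q => // c l2 _ E cl2 al2 bl2 inP yl2 N1 D1 N2 D2 _ _.
apply: (@no_theta V e eS eI free z p q (c :: l2) (l3 ++ y :: l1) c) => //.
- move=> w x wl xB; apply/negP => wx; msplit xB; clash_edge eS.
- exact: mem_head.
- have cy : c != y by apply: contraNneq yH => <-; apply: PH; apply: inP; apply: mem_head.
  by apply/negP; rewrite mem_cat inE (negPf cy) orFb => cB'; msplit cB'; clash_mem.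
- by apply: contra zP; apply: inP.
- have zy : z != y by apply: contraTneq zH => ->.
  apply: contra zP => zB; rewrite mem_cat inE (negPf zy) orFb in zB.
  by rewrite E; msplit zB; memb.
Qed.

End Center.

(** * Chords and detours around them *)

Ltac clash_notin := exfalso;
  match goal with N : is_true (?x \notin ?L) |- _ => solve [refine (negP N _); memb] end.

Ltac clash_irr := exfalso;
  match goal with E : is_true (?r ?x ?x), I : irreflexive ?r |- _ =>
    exact (notF (etrans (esym (I x)) E)) end.

Ltac clash_neq := exfalso;
  match goal with N : is_true (?x != ?x) |- _ => exact (negP N (eqxx x)) end.

Ltac clash eS := first [clash_mem | clash_notin | clash_irr | clash_neq | clash_edge eS].

Section Rung.
Variables (V : finType) (e : rel V).
Hypotheses (eS : symmetric e) (eI : irreflexive e).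
Hypothesis free : ~ has_induced_propeller e.
Variables (y : V) (H : seq V).
Hypothesis yH : y \notin H.
Hypothesis triangle_free : forall x z w,
  x \in y :: H -> z \in y :: H -> w \in y :: H -> e x z -> e z w -> e x w -> False.

(* A cycle of [H] through two neighbours [a] and [b] of [y], cut at [a] and [b] into [t] and [s]. *)
Record nbr_cycle (a b : V) (t s : seq V) : Prop := NbrCycle {
  nbr_cycle_aH : a \in H; nbr_cycle_bH : b \in H; nbr_cycle_ab : a != b; nbr_cycle_ya : e y a; nbr_cycle_yb : e y b;
  nbr_cycle_tH : {subset t <= H}; nbr_cycle_sH : {subset s <= H};
  nbr_cycle_pt : path e a (rcons t b); nbr_cycle_ps : path e a (rcons s b);
  nbr_cycle_at : a \notin t; nbr_cycle_bt : b \notin t; nbr_cycle_as : a \notin s; nbr_cycle_bs : b \notin s;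
  nbr_cycle_disj : disj t s }.

Lemma nbr_cycleC a b t s : nbr_cycle a b t s -> nbr_cycle a b s t.
Proof. by case=> *; constructor=> // x xs xt; match goal with D : disj _ _ |- _ => exact: (D x) end. Qed.

Lemma nbr_cycle_nonadj a b t s : nbr_cycle a b t s -> ~~ e a b.
Proof.
case=> aH bH _ ya yb *; apply/negP => ab.
by apply: (@triangle_free y a b); rewrite ?inE ?eqxx ?aH ?bH ?orbT.
Qed.

(* [uv] is the chord nearest to [a] of the cycle [a t b s], where [t = ta u tb] and [s = sa v sb]. *)
Record rung a b ta u tb sa v sb : Prop := Rung {
  rung_cycle : nbr_cycle a b (ta ++ u :: tb) (sa ++ v :: sb);
  rung_t : ipath e a (ta ++ u :: tb) b;
  rung_s : ipath e a (sa ++ v :: sb) b;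
  rung_yt : no_edge e [:: y] (ta ++ u :: tb);
  rung_ys : no_edge e [:: y] (sa ++ v :: sb);
  rung_uv : e u v;
  rung_ta : no_edge e ta (sa ++ v :: sb);
  rung_sa : no_edge e sa (ta ++ u :: tb) }.

Lemma rungC a b ta u tb sa v sb : rung a b ta u tb sa v sb -> rung a b sa v sb ta u tb.
Proof. by case=> /nbr_cycleC *; constructor=> //; rewrite eS. Qed.

Lemma one_neighbor_cycle a b t s z p q : nbr_cycle a b t s -> ipath e a t b -> no_edge e [:: y] t ->
  z \in H -> z \notin a :: rcons t b -> p \in a :: rcons t b -> q \in a :: rcons t b ->
  e z p -> e z q -> p = q.
Proof.
move=> C It yt; apply: (one_neighbor eS eI free yH triangle_free It (nbr_cycle_nonadj C)
  (nbr_cycle_ya C) (nbr_cycle_yb C)).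
- by move=> w wt; apply: yt; rewrite ?mem_head.
- move=> w wt; msplit wt; [exact: (nbr_cycle_aH C) | exact: (nbr_cycle_bH C) | exact: (nbr_cycle_tH C)].
Qed.

(** The vertex [u] lies off the path through [s], so [v] is its only neighbour there; the rest holds
    because the path through [t] is induced. The chord need not be the nearest one, as [uncross]
    applies this to two crossing chords. *)
Lemma chord_end a b ta u tb sa v sb : nbr_cycle a b (ta ++ u :: tb) (sa ++ v :: sb) ->
  ipath e a (ta ++ u :: tb) b -> ipath e a (sa ++ v :: sb) b ->
  no_edge e [:: y] (sa ++ v :: sb) -> e u v ->
  [/\ no_edge e (a :: ta) (rcons tb b), disj (a :: ta) (rcons tb b),
      no_edge e [:: u] (a :: sa) & no_edge e [:: u] (rcons sb b)] /\
  [/\ u \notin a :: ta, u \notin rcons tb b, u \notin a :: sa & u \notin rcons sb b].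
Proof.
move=> C It Is ys uv; have E : a :: rcons (ta ++ u :: tb) b = (a :: ta) ++ u :: rcons tb b.
  by rewrite rcons_cat.
have [N D] := ipath_sep It (nbr_cycle_nonadj C) E.
have [_ ut _ _] := It; have [_ us _ _] := Is; have [_ _ _ _ _ tH sH _ _ at' bt as' bs ts] := C.
move: ut; rewrite E cat_uniq /= negb_or => /and4P[_ /andP[u1 _] u2 _].
have u3 : u \notin a :: rcons (sa ++ v :: sb) b.
  by apply/negP => M; msplit M; clash eS.
have uH : u \in H by apply: tH; memb.
have vS : v \in a :: rcons (sa ++ v :: sb) b by memb.
have one z : z \in a :: rcons (sa ++ v :: sb) b -> e u z -> z = v.
  by move=> zS uz; apply: (one_neighbor_cycle (nbr_cycleC C) Is ys uH u3).
move: us; have {1}-> : a :: rcons (sa ++ v :: sb) b = (a :: sa) ++ v :: rcons sb b.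
  by rewrite rcons_cat.
rewrite cat_uniq /= negb_or => /and4P[_ /andP[v1 _] v2 _].
split; split=> //.
- move=> x z; rewrite inE => /eqP-> zS; apply/negP => uz; have zv : z = v.
    by apply: one => //; msplit zS; memb.
  by move: v1; rewrite -zv zS.
- move=> x z; rewrite inE => /eqP-> zS; apply/negP => uz; have zv : z = v.
    by apply: one => //; msplit zS; memb.
  by move: v2; rewrite -zv zS.
- by apply: contra u3 => M; msplit M; memb.
- by apply: contra u3 => M; msplit M; memb.
Qed.

Lemma rung_end a b ta u tb sa v sb : rung a b ta u tb sa v sb ->
  [/\ no_edge e (a :: ta) (rcons tb b), disj (a :: ta) (rcons tb b),
      no_edge e [:: u] (a :: sa) & no_edge e [:: u] (rcons sb b)] /\
  [/\ u \notin a :: ta, u \notin rcons tb b, u \notin a :: sa & u \notin rcons sb b].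
Proof. by case=> C It Is _ ys uv _ _; exact: (chord_end C It Is ys uv). Qed.

(** Here the choice of [uv] nearest to [a] matters: no chord starts before it on either path. *)
Lemma rung_sides a b ta u tb sa v sb : rung a b ta u tb sa v sb ->
  no_edge e ((a :: ta) ++ a :: sa) (rcons tb b ++ rcons sb b) /\
  disj ((a :: ta) ++ a :: sa) (rcons tb b ++ rcons sb b).
Proof.
move=> R; have [[N1 D1 U1 U2] [u1 u2 u3 u4]] := rung_end R.
have [[N2 D2 U3 U4] [v1 v2 v3 v4]] := rung_end (rungC R).
have [C _ _ _ _ uv nta nsa] := R.
have [_ _ ab _ _ _ _ _ _ at' bt as' bs ts] := C.
split.
- by move=> x z xA zB; apply/negP => xz; msplit xA; msplit zB; clash_edge eS.
- by move=> x xA xB; msplit xA; msplit xB; clash eS.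
Qed.

(* [Q] is a shortest connection, avoiding the chord [uv], from the part of the cycle
   before [uv] to the part after it; it leaves at [p] and arrives at [r]. *)
Record detour a b ta u tb sa v sb Q p r : Prop := Detour {
  det_Q0 : Q <> [::];
  det_H : {subset Q <= H};
  det_u : u \notin Q;
  det_v : v \notin Q;
  det_uniq : uniq Q;
  det_p : p \in (a :: ta) ++ a :: sa;
  det_r : r \in rcons tb b ++ rcons sb b;
  det_path : path e p (rcons Q r);
  det_A : disj Q ((a :: ta) ++ a :: sa);
  det_B : disj Q (rcons tb b ++ rcons sb b);
  det_cut : forall L1 x L2, Q = L1 ++ x :: L2 -> [/\ no_edge e L1 L2,
    no_edge e ((a :: ta) ++ a :: sa) L2 & no_edge e L1 (rcons tb b ++ rcons sb b)] }.

Lemma detourC a b ta u tb sa v sb Q p r :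
  detour a b ta u tb sa v sb Q p r -> detour a b sa v sb ta u tb Q p r.
Proof.
case=> Q0 QH uQ vQ uq pA rB pQ QA QB cut; constructor=> //.
- by msplit pA; memb.
- by msplit rB; memb.
- by move=> x xQ xA; apply: (QA x xQ); msplit xA; memb.
- by move=> x xQ xA; apply: (QB x xQ); msplit xA; memb.
- move=> L1 x L2 E; have [c1 c2 c3] := cut _ _ _ E; split=> //.
  + by move=> w z wA zL; apply: c2 => //; msplit wA; memb.
  + by move=> w z wA zL; apply: c3 => //; msplit zL; memb.
Qed.

Lemma detour_exists a b ta u tb sa v sb : rung a b ta u tb sa v sb ->
  connect (avoid e H u v) a b ->
  exists Q p r, detour a b ta u tb sa v sb Q p r.
Proof.
move=> R /connectP[l pl lb]; have C := rung_cycle R; have [NN DD] := rung_sides R.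
rewrite /avoid in pl; set M := [seq w <- H | _] in pl.
have lM : {subset l <= M}.
  elim: l (a) pl {lb} => //= z l IH x /andP[/and3P[_ _ zM] /IH lM] w.
  by rewrite inE => /orP[/eqP->|/lM].
have {}pl : path e a l by apply: sub_path pl => x z /= /and3P[].
case/lastP: l lM pl lb => [|Q0 b'] lM pl lb; first by move: (nbr_cycle_ab C); rewrite lb eqxx.
rewrite last_rcons in lb; subst b'.
have Q00 : Q0 <> [::].
  by move=> Q00; move: pl (nbr_cycle_nonadj C); rewrite Q00 /= andbT => ->.
have Q0M : {subset Q0 <= M} by move=> x xQ; apply: lM; memb.
have [||Q [p [r [[pA rB QM pQ] [Qn uQ cut]]]]] :=
  @shortest_link V e ((a :: ta) ++ a :: sa) (rcons tb b ++ rcons sb b) M a b Q0 _ _ Q00 Q0M pl.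
- by memb.
- by memb.
exists Q, p, r; constructor=> //.
- by move=> x /QM; rewrite mem_filter => /andP[].
- by apply/negP => /QM; rewrite mem_filter eqxx.
- by apply/negP => /QM; rewrite mem_filter eqxx andbF.
(* Minimality excludes only vertices other than the last one of [Q]; the last one is adjacent to
   [r], while the two sides of the chord are anticomplete. *)
- move=> x xQ xA; have [L1 [L2 E]] := in_split xQ; have [c1 _ _ _ _] := cut _ _ _ E.
  case: L2 E c1 => [|z L2] E c1; last by rewrite xA in c1; case: (negP (c1 _)).
  move: pQ; rewrite E cats1 !rcons_path last_rcons => /andP[_ xr].
  by move: (NN x r xA rB); rewrite xr.
- move=> x xQ xA; have [L1 [L2 E]] := in_split xQ; have [_ c1 _ _ _] := cut _ _ _ E.
  case: L1 E c1 => [|z L1] E c1; last by rewrite xA in c1; case: (negP (c1 _)).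
  by move: pQ; rewrite E /= => /andP[px _]; move: (NN p x pA xA); rewrite px.
- by move=> L1 x L2 /cut[].
Qed.

Lemma conn_A a b ta u tb sa v sb : rung a b ta u tb sa v sb -> conn e ((a :: ta) ++ a :: sa).
Proof.
move=> R; move: (nbr_cycle_pt (rung_cycle R)) (nbr_cycle_ps (rung_cycle R)).
rewrite !rcons_cat !cat_path => /andP[pt _] /andP[ps _].
apply: (conn_cat eS (path_conn eS pt) (path_conn eS ps) (mem_head _ _) (mem_head _ _)).
by rewrite eqxx.
Qed.

Lemma conn_B a b ta u tb sa v sb : rung a b ta u tb sa v sb -> conn e (rcons tb b ++ rcons sb b).
Proof.
move=> R; move: (nbr_cycle_pt (rung_cycle R)) (nbr_cycle_ps (rung_cycle R)).
rewrite !rcons_cat !cat_path /= => /and3P[_ _ pt] /and3P[_ _ ps].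
apply: (conn_cat eS (path_conn_tail eS pt) (path_conn_tail eS ps) (mem_rconsr _ _) (mem_rconsr _ _)).
by rewrite eqxx.
Qed.

Lemma attached_ends a b ta u tb sa v sb : rung a b ta u tb sa v sb ->
  attached e u (a :: ta) /\ attached e u (rcons tb b).
Proof.
move=> R; move: (nbr_cycle_pt (rung_cycle R)); rewrite !rcons_cat !cat_path /= => /and3P[_ au pt]; split.
  by exists (last a ta); rewrite ?mem_last // eS.
by case: (tb) pt => [|z l] /= /andP[uz _]; [exists b | exists z]; rewrite ?mem_head.
Qed.

(* A neighbour [z] of [u] on [Q] would make [u] the center of a propeller with
   neighbours [v] and [z]: the two sides of the chord are joined through [z]. *)
Lemma detour_u a b ta u tb sa v sb Q p r : rung a b ta u tb sa v sb ->
  detour a b ta u tb sa v sb Q p r -> no_edge e [:: u] Q.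
Proof.
move=> R D x z; rewrite inE => /eqP-> zQ; apply/negP => uz.
have [[N1 D1 U1 U2] [u1 u2 u3 u4]] := rung_end R.
have [NN DD] := rung_sides R; have cA := conn_A R; have cB := conn_B R.
have [va vb] := attached_ends (rungC R).
have [C _ _ _ _ uv _ _] := R; have [aH _ _ _ _ tH sH _ _ _ _ _ _ _] := C.
have [Q0 QH uQ vQ uq pA rB pQ QA QB cut] := D.
have [m1 [m2 E]] := in_split zQ; have [c1 c2 c3] := cut _ _ _ E.
move: pQ; rewrite E rcons_cat cat_path /= => /and3P[pm1 lz pm2].
have nvz : ~~ e v z.
  apply/negP => vz; apply: (@triangle_free u v z) => //; rewrite inE.
  - by rewrite tH ?orbT //; memb.
  - by rewrite sH ?orbT //; memb.
  - by rewrite QH ?orbT.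
have subm1 w : w \in m1 -> w \in Q by move=> wm; rewrite E; memb.
have subm2 w : w \in m2 -> w \in Q by move=> wm; rewrite E; memb.
apply: (@no_theta V e eS eI free u v z (((a :: ta) ++ a :: sa) ++ m1)
  ((rcons tb b ++ rcons sb b) ++ rcons m2 r) a) => //.
- by apply: contraNneq vQ => ->.
- exact: (conn_path_cat eS cA pA pm1).
- by apply: (conn_cat eS cB (path_conn_tail eS pm2) rB (mem_rconsr _ _)); rewrite eqxx.
- by case: va => w wA vw; exists w => //; memb.
- exists (last p m1); rewrite 1?eS // mem_cat.
  by case/lastP: (m1) => [|? ?]; rewrite ?pA // last_rcons mem_rconsr orbT.
- by case: vb => w wA vw; exists w => //; memb.
- by case: (m2) pm2 => [|w m] /= /andP[zw _]; [exists r | exists w] => //; memb.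
- by move=> w x' wA xB; apply/negP => wx; msplit xB; msplit wA; clash_edge eS.
- by memb.
- apply/negP => M; rewrite mem_cat in M; case/orP: M => M.
    by apply: (DD a) => //; memb.
  rewrite mem_rcons inE in M; case/orP: M => [/eqP ar|M].
    by apply: (DD r) => //; rewrite -ar; memb.
  by apply: (QA a (subm2 _ M)); memb.
- apply/negP => M; rewrite mem_cat in M; case/orP: M => M; last by rewrite subm1 in uQ.
  by msplit M; clash_notin.
- apply/negP => M; rewrite mem_cat in M; case/orP: M => M; first by msplit M; clash_notin.
  rewrite mem_rcons inE in M; case/orP: M => [/eqP ar|M]; last by rewrite subm2 in uQ.
  by move: rB; rewrite -ar mem_cat (negPf u2) (negPf u4).
Qed.

End Rung.

(** * How a detour attaches to the side of [a] *)

Section Reroute.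
Variables (V : finType) (e : rel V).
Hypotheses (eS : symmetric e) (eI : irreflexive e).
Hypothesis free : ~ has_induced_propeller e.
Variables (y : V) (H : seq V).
Hypothesis yH : y \notin H.
Hypothesis triangle_free : forall x z w,
  x \in y :: H -> z \in y :: H -> w \in y :: H -> e x z -> e z w -> e x w -> False.

Notation nbr_cycle := (nbr_cycle e y H).
Notation rung := (rung e y H).
Notation detour := (detour e H).

Lemma detour_first a b ta u tb sa v sb Q p r z w : detour a b ta u tb sa v sb Q p r ->
  z \in Q -> w \in (a :: ta) ++ a :: sa -> e z w -> exists Q', Q = z :: Q'.
Proof.
move=> D zQ wA zw; have [Q0 _ _ _ _ _ _ _ _ _ cut] := D.
case: Q Q0 zQ D cut => // x Q _ zQ D cut; have [_ c _] := cut [::] x Q erefl.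
move: zQ; rewrite inE => /orP[/eqP->|zQ]; first by exists Q.
by move: (c w z wA zQ); rewrite eS zw.
Qed.

Lemma detour_last a b ta u tb sa v sb Q p r z w : detour a b ta u tb sa v sb Q p r ->
  z \in Q -> w \in rcons tb b ++ rcons sb b -> e z w -> exists Q', Q = rcons Q' z.
Proof.
move=> D zQ wA zw; have [Q0 _ _ _ _ _ _ _ _ _ cut] := D.
case/lastP: Q Q0 zQ D cut => // Q x _ zQ D cut.
have [_ _ c] := cut Q x [::] (esym (cats1 _ _)).
move: zQ; rewrite mem_rcons inE => /orP[/eqP->|zQ]; first by exists Q.
by move: (c z w zQ wA); rewrite zw.
Qed.

Lemma detour_notin a b ta u tb sa v sb Q p r z : detour a b ta u tb sa v sb Q p r ->
  z \in Q -> z \notin a :: rcons (ta ++ u :: tb) b.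
Proof.
move=> [_ _ uQ vQ _ _ _ _ QA QB _] zQ; apply/negP => M; msplit M; clash eS.
Qed.

Lemma detour_ta a b ta u tb sa v sb Q p r z w : rung a b ta u tb sa v sb ->
  detour a b ta u tb sa v sb Q p r -> p \in a :: ta ->
  z \in Q -> w \in a :: ta -> e z w -> w = p.
Proof.
move=> R D pa zQ wa zw; have [Q' E] : exists Q', Q = z :: Q'.
  by apply: (detour_first D zQ _ zw); memb.
have zp : e z p by have := det_path D; rewrite E /= eS => /andP[].
apply: (one_neighbor_cycle eS eI free yH triangle_free (rung_cycle R) (rung_t R) (rung_yt R)
  (det_H D zQ) (detour_notin D zQ)) => //.
- by msplit wa; memb.
- by msplit pa; memb.
Qed.

(** If the first vertex [z] of [Q] saw both [p] in [ta] and [w] in [sa], it would be a center: [p]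
    and [w] are joined through [a] and also through the chord [uv]. The case [p = a] falls to the
    uniqueness of the neighbour on the path through [s]. *)
Lemma detour_sa a b ta u tb sa v sb Q p r : rung a b ta u tb sa v sb ->
  detour a b ta u tb sa v sb Q p r -> p \in a :: ta -> no_edge e Q sa.
Proof.
move=> R D pa z w zQ wsa; apply/negP => zw; have [Q' E] : exists Q', Q = z :: Q'.
  by apply: (detour_first D zQ _ zw); memb.
have zp : e z p by have := det_path D; rewrite E /= eS => /andP[].
have [C It Is yt ys uv nta nsa] := R; have [aH _ _ _ _ tH sH pt ps at' bt as' bs ts] := C.
have C' := nbr_cycleC C.
move: pa; rewrite inE => /orP[/eqP pa|pta].
  have := one_neighbor_cycle eS eI free yH triangle_free C' Is ys (det_H D zQ)
    (detour_notin (detourC D) zQ) _ _ zp zw.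
  by rewrite pa => pw; rewrite pw in as'; [clash_notin | memb | memb].
have [l1 [l2 Et]] := in_split pta; have [m1 [m2 Es]] := in_split wsa.
have [_ _ uQ vQ _ _ _ _ QA QB _] := D.
subst ta sa.
have [N1 D1] : no_edge e (a :: l1) (l2 ++ u :: rcons tb b) /\ disj (a :: l1) (l2 ++ u :: rcons tb b).
  by apply: (ipath_sep It (nbr_cycle_nonadj triangle_free C)); rewrite rcons_cat -catA.
have [N2 D2] : no_edge e (a :: m1) (m2 ++ v :: rcons sb b) /\ disj (a :: m1) (m2 ++ v :: rcons sb b).
  by apply: (ipath_sep Is (nbr_cycle_nonadj triangle_free C)); rewrite rcons_cat -catA.
move: pt; rewrite rcons_cat -catA cat_path /= cat_path /= => /and5P[pl1 ap pl2 pu _].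
move: ps; rewrite rcons_cat -catA cat_path /= cat_path /= => /and5P[pm1 aw pm2 wv _].
have cl2 : conn e (rcons l2 u) by apply: (@path_conn_tail V e eS p); rewrite rcons_path pl2.
have cm2 : conn e (rcons m2 v) by apply: (@path_conn_tail V e eS w); rewrite rcons_path pm2.
apply: (@no_theta V e eS eI free z p w ((a :: l1) ++ a :: m1) (rcons l2 u ++ rcons m2 v) a) => //.
- by apply/eqP => pw; subst w; clash_mem.
- by apply: nta; memb.
- by apply: (conn_cat eS (path_conn eS pl1) (path_conn eS pm1) (mem_head _ _) (mem_head _ _)); rewrite eqxx.
- by apply: (conn_cat eS cl2 cm2 (mem_rconsr _ _) (mem_rconsr _ _)); rewrite uv orbT.
- by exists (last a l1); rewrite 1?eS // mem_cat mem_last.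
- by exists (last a m1); rewrite 1?eS // mem_cat mem_last orbT.
- by case: (l2) pl2 pu => [|c l] /= => [_ ?|/andP[pc _] _]; [exists u | exists c] => //; memb.
- by case: (m2) pm2 wv => [|c l] /= => [_ ?|/andP[pc _] _]; [exists v | exists c] => //; memb.
- by move=> x x' xA xB; apply/negP => xx; msplit xA; msplit xB; clash_edge eS.
- by memb.
- by apply/negP => M; msplit M; clash eS.
- by apply/negP => M; msplit M; clash eS.
- by apply/negP => M; msplit M; clash eS.
Qed.

(** Otherwise [p] is the last vertex of [ta], and [u] is a center for its neighbours [v] and [p]:
    one connection runs back through [a], the other through [Q] and the side of [b]. *)
Lemma detour_pu a b ta u tb sa v sb Q p r : rung a b ta u tb sa v sb ->
  detour a b ta u tb sa v sb Q p r -> p \in a :: ta -> ~~ e p u.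
Proof.
move=> R D pa; apply/negP => pu.
have [[N1 D1 U1 U2] [u1 u2 u3 u4]] := rung_end eS eI free yH triangle_free R.
have [NN DD] := rung_sides eS eI free yH triangle_free R.
have [va vb] := attached_ends eS (rungC eS R).
have Qu := detour_u eS eI free yH triangle_free R D.
have Qsa := detour_sa R D pa; have Qta := @detour_ta _ _ _ _ _ _ _ _ _ _ _ _ _ R D pa.
have cB := conn_B eS R.
have [C It Is yt ys uv nta nsa] := R; have [aH _ _ _ _ tH sH pt ps at' bt as' bs ts] := C.
have [Q0 QH uQ vQ uq pA rB pQ QA QB cut] := D.
have pna : p != a by apply/eqP => pa'; subst p; clash_edge eS.
move: pa; rewrite inE (negPf pna) => /= pta; have [l1 [l2 Et]] := in_split pta.
case: l2 Et => [|c l2] Et; last first.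
  have [|N _] := @ipath_sep V e _ _ _ (a :: l1 ++ [:: p]) c (l2 ++ u :: rcons tb b)
    It (nbr_cycle_nonadj triangle_free C); first by rewrite Et rcons_cat -!catA /= -catA.
  by clash_edge eS.
subst ta; have [N2 D2] : no_edge e (a :: l1) (u :: rcons tb b) /\ disj (a :: l1) (u :: rcons tb b).
  by apply: (ipath_sep It (nbr_cycle_nonadj triangle_free C)); rewrite rcons_cat -catA.
have [_ ut _ _] := It.
have pl : p \notin a :: l1.
  have Eu : a :: rcons ((l1 ++ [:: p]) ++ u :: tb) b = (a :: l1) ++ p :: u :: rcons tb b.
    by rewrite rcons_cat -catA.
  by move: ut; rewrite Eu cat_uniq => /and3P[_ /hasPn/(_ p (mem_head _ _))].
move: pt; rewrite rcons_cat -catA cat_path /= => /and4P[pl1 ap _ _].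
move: ps; rewrite rcons_cat cat_path /= => /and3P[pm1 aw _].
apply: (@no_theta V e eS eI free u v p ((a :: l1) ++ a :: sa)
  ((rcons tb b ++ rcons sb b) ++ rcons Q r) a) => //.
- by rewrite eS.
- by apply/eqP => vp; subst v; clash_mem.
- by rewrite eS; apply: nta; memb.
- by apply: (conn_cat eS (path_conn eS pl1) (path_conn eS pm1) (mem_head _ _) (mem_head _ _)); rewrite eqxx.
- by apply: (conn_cat eS cB (path_conn_tail eS pQ) rB (mem_rconsr _ _)); rewrite eqxx.
- by case: va => w wA vw; exists w => //; memb.
- by exists (last a l1); rewrite 1?eS // mem_cat mem_last.
- by case: vb => w wA vw; exists w => //; memb.
- by case: (Q) Q0 pQ => //= c l _ /andP[pc _]; exists c => //; memb.
- have Qa x x' : x \in Q -> x' \in a :: l1 -> ~~ e x x'.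
    move=> xQ xa; apply/negP => xx; move: pl; rewrite -(Qta x x' xQ _ xx) ?xa //.
    by msplit xa; memb.
  move=> x x' xA xB; apply/negP => xx; rewrite mem_cat in xB; case/orP: xB => xB.
    by msplit xA; clash_edge eS.
  rewrite mem_rcons inE in xB; case/orP: xB => [/eqP xr|xB].
    by subst x'; msplit xA; clash_edge eS.
  rewrite mem_cat in xA; case/orP: xA => xA; first by move: (Qa x' x xB xA); rewrite eS xx.
  rewrite inE in xA; case/orP: xA => [/eqP xa|xA]; last by clash_edge eS.
  by subst x; move: (Qa x' a xB (mem_head _ _)); rewrite eS xx.
- by memb.
- apply/negP => M; rewrite mem_cat in M; case/orP: M => M.
    by apply: (DD a) => //; memb.
  rewrite mem_rcons inE in M; case/orP: M => [/eqP ar|M].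
    by apply: (DD r) => //; rewrite -ar; memb.
  by apply: (QA a M); memb.
- by apply/negP => M; msplit M; clash eS.
- apply/negP => M; rewrite mem_cat in M; case/orP: M => M; first by msplit M; clash_notin.
  rewrite mem_rcons inE in M; case/orP: M => [/eqP ar|M]; last by clash_notin.
  by move: rB; rewrite -ar mem_cat (negPf u2) (negPf u4).
Qed.

End Reroute.

(** * Rerouting the cycle along a detour *)

Section Bypass.
Variables (V : finType) (e : rel V).
Hypotheses (eS : symmetric e) (eI : irreflexive e).
Hypothesis free : ~ has_induced_propeller e.
Variables (y : V) (H : seq V).
Hypothesis yH : y \notin H.
Hypothesis triangle_free : forall x z w,
  x \in y :: H -> z \in y :: H -> w \in y :: H -> e x z -> e z w -> e x w -> False.

Notation nbr_cycle := (nbr_cycle e y H).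
Notation rung := (rung e y H).
Notation detour := (detour e H).

Lemma path_suffix c l1 l2 b d z : path e c (rcons (l1 ++ l2) b) -> z = head b l2 -> e d z ->
  path e d (rcons l2 b).
Proof.
rewrite rcons_cat cat_path => /andP[_]; case: l2 => [|x l2] /=; first by move=> _ -> ->.
by move=> /andP[_ pl] -> ->.
Qed.

Lemma split_suffix r (l : seq V) b : r \in rcons l b ->
  exists l1 l2, l = l1 ++ l2 /\ r = head b l2.
Proof.
rewrite mem_rcons inE => /orP[/eqP->|/in_split[l1 [l2 E]]].
  by exists l, [::]; rewrite cats0.
by exists l1, (r :: l2).
Qed.

Lemma cross_in (t s : seq V) x z : e x z -> x \in t -> z \in s -> (x, z) \in cross e t s.
Proof. by rewrite inE /= => -> -> ->. Qed.

Lemma cross_notin (t s : seq V) x z : x \notin t -> z \notin t -> (x, z) \notin cross e t s.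
Proof. by rewrite inE /= => /negPf-> /negPf->; rewrite !andbF. Qed.

Section Fixed.
Variables (a b : V) (ta : seq V) (u : V) (tb sa : seq V) (v : V) (sb Q : seq V) (p r : V).
Hypotheses (R : rung a b ta u tb sa v sb) (D : detour a b ta u tb sa v sb Q p r).
Hypothesis pa : p \in a :: ta.

(** The detour returns to the path that it left, and [u] drops out of the cycle. Writing [z] as
    [head b tb2] covers a return at [b] itself, with [tb2] empty. *)
Lemma reroute_top pre post tb1 tb2 z : ta = pre ++ post -> p = last a pre -> tb = tb1 ++ tb2 ->
  z = head b tb2 -> e (last p Q) z -> nbr_cycle a b (pre ++ Q ++ tb2) (sa ++ v :: sb).
Proof.
move=> Ea Ep Eb Ez qz; have [C _ _ _ _ _ _ _] := R.
have [aH bH ab ya yb tH sH pt ps at' bt as' bs ts] := C.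
have [Q0 QH uQ vQ uq pA rB pQ QA QB cut] := D.
have QS : disj Q (sa ++ v :: sb) by move=> x xQ xS; msplit xS; clash eS.
move: (pt) pQ; rewrite !rcons_cat !rcons_path cat_path /= => /and3P[pta _ pb] /andP[pQ _].
have pQb : path e (last p Q) (rcons tb2 b).
  by rewrite Eb in pb; apply: path_suffix pb Ez qz.
rewrite Ea cat_path -Ep in pta; case/andP: pta => ppre _; subst ta tb.
constructor=> //.
- by move=> x xt; msplit xt; [apply: tH; memb | exact: QH | apply: tH; memb].
- by rewrite !rcons_cat !cat_path ppre -Ep pQ.
- by apply/negP => M; msplit M; clash eS.
- by apply/negP => M; msplit M; clash eS.
- by move=> x xt xs; rewrite !mem_cat in xt; case/or3P: xt => xt; clash eS.
Qed.

(** The detour crosses over to the other path, so the remaining path must cross as well: it uses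
    [uv] as an edge of the cycle, and [uv] stops being a chord. *)
Lemma reroute_bottom pre post sb1 sb2 z : ta = pre ++ post -> p = last a pre -> sb = sb1 ++ sb2 ->
  z = head b sb2 -> e (last p Q) z -> nbr_cycle a b (pre ++ Q ++ sb2) (sa ++ v :: u :: tb).
Proof.
move=> Ea Ep Eb Ez qz; have [C _ _ _ _ uv _ _] := R.
have [[N1 D1 U1 U2] [u1 u2 u3 u4]] := rung_end eS eI free yH triangle_free R.
have [[N2 D2 U3 U4] [v1 v2 v3 v4]] := rung_end eS eI free yH triangle_free (rungC eS R).
have [aH bH ab ya yb tH sH pt ps at' bt as' bs ts] := C.
have [Q0 QH uQ vQ uq pA rB pQ QA QB cut] := D.
move: (pt) (ps) pQ; rewrite !rcons_cat !rcons_path !cat_path /=.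
move=> /and3P[pta _ ptb] /and3P[psa av pb] /andP[pQ _].
have pQb : path e (last p Q) (rcons sb2 b).
  by rewrite Eb in pb; apply: path_suffix pb Ez qz.
rewrite Ea cat_path -Ep in pta; case/andP: pta => ppre _; subst ta sb.
constructor=> //.
- by move=> x xt; msplit xt; [apply: tH; memb | exact: QH | apply: sH; memb].
- by move=> x xt; msplit xt; [apply: sH; memb | apply: sH; memb | apply: tH; memb | apply: tH; memb].
- by rewrite !rcons_cat !cat_path ppre -Ep pQ.
- by rewrite !rcons_cat !cat_path /= psa av eS uv.
- by apply/negP => M; msplit M; clash eS.
- by apply/negP => M; msplit M; clash eS.
- by apply/negP => M; msplit M; clash eS.
- by apply/negP => M; msplit M; clash eS.
- by move=> x xt xs; msplit xt; msplit xs; clash eS.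
Qed.

Lemma cross_top pre post tb1 tb2 x z : ta = pre ++ post -> tb = tb1 ++ tb2 ->
  x \in pre ++ Q ++ tb2 -> z \in sa ++ v :: sb -> e x z ->
  (x, z) \in cross e (ta ++ u :: tb) (sa ++ v :: sb) \/ [/\ x \in Q, z \in sb & x = last p Q].
Proof.
move=> Ea Eb xt zs xz; have Qsa := detour_sa eS eI free yH triangle_free R D pa.
have Qv := detour_u eS eI free yH triangle_free (rungC eS R) (detourC D).
rewrite !mem_cat in xt; case/or3P: xt => xt.
- by left; apply: cross_in => //; rewrite Ea; memb.
- msplit zs; try clash_edge eS; right; split=> //.
  have [|Q' ->] := detour_last D xt _ xz; first by memb.
  by rewrite last_rcons.
- by left; apply: cross_in => //; rewrite Eb; memb.
Qed.

(** As [u] and [sb2] change paths, old path edges at [u] and [v] could become chords. [detour_pu]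
    keeps [u] from seeing [pre], and a nonempty [sb1] keeps [v] from seeing [sb2]. *)
Lemma cross_bottom pre post sb1 sb2 x z : ta = pre ++ post -> p = last a pre ->
  sb = sb1 ++ sb2 -> sb1 <> [::] ->
  x \in pre ++ Q ++ sb2 -> z \in sa ++ v :: u :: tb -> e x z ->
  (x, z) \in cross e (ta ++ u :: tb) (sa ++ v :: sb) \/ [/\ x \in Q, z \in tb & x = last p Q].
Proof.
move=> Ea Ep Eb Eb1 xt zs xz.
have Qsa := detour_sa eS eI free yH triangle_free R D pa.
have Qu := detour_u eS eI free yH triangle_free R D.
have Qv := detour_u eS eI free yH triangle_free (rungC eS R) (detourC D).
have pu := detour_pu eS eI free yH triangle_free R D pa.
have [[N1 D1 U1 U2] [u1 u2 u3 u4]] := rung_end eS eI free yH triangle_free R.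
have [[N2 D2 U3 U4] [v1 v2 v3 v4]] := rung_end eS eI free yH triangle_free (rungC eS R).
have [C It Is _ _ uv nta nsa] := R.
have pre_u : no_edge e pre [:: u].
  move=> w w'; rewrite inE => wp /eqP->; apply/negP => wu; have [l1 [l2 E]] := in_split wp.
  case E2: (l2 ++ post) => [|c l3].
    move: E2; case: l2 E => // E _; move: pu; rewrite Ep E last_cat /= wu //.
  have [|N _] := @ipath_sep V e _ _ _ (a :: l1 ++ [:: w]) c (l3 ++ u :: rcons tb b)
    It (nbr_cycle_nonadj triangle_free C); last by clash_edge eS.
  by rewrite Ea E rcons_cat -!catA /= -catA /= [l2 ++ _]catA E2.
have v_sb : no_edge e [:: v] sb2.
  case: sb1 Eb Eb1 => // c l Eb _ w w'; rewrite inE => /eqP-> wp.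
  have [|N _] := @ipath_sep V e _ _ _ (a :: sa ++ [:: v]) c (l ++ rcons sb2 b)
    Is (nbr_cycle_nonadj triangle_free C); last by apply: N; memb.
  by rewrite Eb rcons_cat /= rcons_cat -catA.
rewrite !mem_cat in xt; case/or3P: xt => xt.
- have xta : x \in ta by rewrite Ea; memb.
  by msplit zs; clash_edge eS.
- msplit zs; try clash_edge eS; right; split=> //.
  have [|Q' ->] := detour_last D xt _ xz; first by memb.
  by rewrite last_rcons.
- have xsb : x \in sb by rewrite Eb; memb.
  msplit zs; try clash_edge eS; left; rewrite cross_flip //; apply: cross_in; rewrite 1?eS //; memb.
Qed.

Lemma one_top z w w' : z \in Q -> w \in rcons tb b -> w' \in rcons tb b ->
  e z w -> e z w' -> w = w'.
Proof.
move=> zQ wt wt' zw zw'; have zN := detour_notin D zQ.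
apply: (one_neighbor_cycle eS eI free yH triangle_free (rung_cycle R) (rung_t R)
  (rung_yt R) (det_H D zQ) zN _ _ zw zw').
- by msplit wt; memb.
- by msplit wt'; memb.
Qed.

End Fixed.

(* Let [q] be the last vertex of [Q]. If all its neighbours after the chord are on one side of
   the cycle, that side is rerouted through [Q], which drops the chord [uv]. If it has
   a neighbour on each side, one new chord appears; either another chord is dropped as well,
   or the two neighbours lie on a common chordless cycle and [q] is a center. *)
Lemma bypass (G : Prop) a b ta u tb sa v sb Q p r :
  rung a b ta u tb sa v sb -> detour a b ta u tb sa v sb Q p r -> p \in a :: ta ->
  (forall a b t s, nbr_cycle a b t s ->
     #|cross e t s| < #|cross e (ta ++ u :: tb) (sa ++ v :: sb)| -> G) -> G.
Proof.
move=> R D pa IH.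
have [[N1 D1 U1 U2] [u1 u2 u3 u4]] := rung_end eS eI free yH triangle_free R.
have [[N2 D2 U3 U4] [v1 v2 v3 v4]] := rung_end eS eI free yH triangle_free (rungC eS R).
have Qu := detour_u eS eI free yH triangle_free R D.
have Qv := detour_u eS eI free yH triangle_free (rungC eS R) (detourC D).
have one1 := @one_top _ _ _ _ _ _ _ _ _ _ _ R D.
have one2 := @one_top _ _ _ _ _ _ _ _ _ _ _ (rungC eS R) (detourC D).
have [NN DD] := rung_sides eS eI free yH triangle_free R.
have [C It Is yt ys uv nta nsa] := R.
have [aH bH ab ya yb tH sH pt ps at' bt as' bs ts] := C.
have [Q0 QH uQ vQ uq pA rB pQ QA QB cut] := D.
have [pre [post [Ea Ep]]] : exists pre post, ta = pre ++ post /\ p = last a pre.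
  by case/splitPl: pa => pre post <-; exists pre, post.
set q := last p Q.
have qQ : q \in Q by rewrite /q; case: (Q) Q0 => //= x l _; rewrite mem_last.
have qr : e q r by move: pQ; rewrite rcons_path => /andP[].
have uvX : (u, v) \in cross e (ta ++ u :: tb) (sa ++ v :: sb) by apply: cross_in => //; memb.
have spre w : w \in pre -> w \in ta by rewrite Ea => wp; memb.
have ut' tb1 tb2 : tb = tb1 ++ tb2 -> u \notin pre ++ Q ++ tb2.
  by move=> E; subst tb; apply/negP => M; rewrite !mem_cat in M; case/or3P: M => M; try (move/spre: M => M); clash eS.
have vt' tb1 tb2 : tb = tb1 ++ tb2 -> v \notin pre ++ Q ++ tb2.
  by move=> E; subst tb; apply/negP => M; rewrite !mem_cat in M; case/or3P: M => M; try (move/spre: M => M); clash eS.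
have us' sb1 sb2 : sb = sb1 ++ sb2 -> u \notin pre ++ Q ++ sb2.
  by move=> E; subst sb; apply/negP => M; rewrite !mem_cat in M; case/or3P: M => M; try (move/spre: M => M); clash eS.
have vs' sb1 sb2 : sb = sb1 ++ sb2 -> v \notin pre ++ Q ++ sb2.
  by move=> E; subst sb; apply/negP => M; rewrite !mem_cat in M; case/or3P: M => M; try (move/spre: M => M); clash eS.
case Hs: (has (e q) sb); last first.
  have rt : r \in rcons tb b.
    move: (rB); rewrite mem_cat => /orP[//|M]; rewrite mem_rcons inE in M.
    case/orP: M => [/eqP->|rs]; first by memb.
    by move/hasPn: Hs => /(_ r rs); rewrite qr.
  have [tb1 [tb2 [Eb Er]]] := split_suffix rt.
  apply: (IH _ _ _ _ (reroute_top R D pa Ea Ep Eb Er qr)).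
  apply: (cross_lt1 eS) uvX (cross_notin _ (ut' _ _ Eb) (vt' _ _ Eb)) => x z xt zs xz.
  have [//|[xQ zb xq]] := cross_top R D pa Ea Eb xt zs xz.
  by move/hasPn: Hs => /(_ z zb); rewrite /q -xq xz.
have [r2 r2s qr2] := hasP Hs.
have [s1 [s2 Es]] := in_split r2s.
have Es' : r2 = head b (r2 :: s2) by [].
case Ht: (has (e q) (rcons tb b)); last first.
  (* If [r2] came right after [v], then [v] would be a center for [u] and [r2]: one connection uses
     the side of [a] and [Q], the other the side of [b]. *)
  have s10 : s1 <> [::].
    move=> s10; rewrite s10 /= in Es; subst sb.
    move: (pt) (ps) (pQ); rewrite !rcons_cat !rcons_path !cat_path /=.
    move=> /and3P[pta au ptb] /and4P[psa av vr2 ps2'] /andP[pQ' _].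
    have [N4 D4] : no_edge e (a :: sa ++ [:: v]) (rcons s2 b) /\ disj (a :: sa ++ [:: v]) (rcons s2 b).
      apply: (@ipath_sep V e _ _ _ (a :: sa ++ [:: v]) r2 (rcons s2 b) Is (nbr_cycle_nonadj triangle_free C)).
      by rewrite rcons_cat /= -catA.
    have [w wt uw] : attached e u (rcons tb b) := (attached_ends eS R).2.
    apply: (@no_theta V e eS eI free v u r2 (((a :: ta) ++ a :: sa) ++ Q)
       (rcons tb b ++ rcons s2 b) a) => //.
    - by rewrite eS.
    - by apply/eqP => E; subst r2; clash_notin.
    - by apply: U2; memb.
    - exact: (conn_path_cat eS (conn_A eS R) pA pQ').
    - apply: (conn_cat eS (path_conn_tail eS ptb) (path_conn_tail eS ps2') (mem_rconsr _ _) (mem_rconsr _ _)).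
      by rewrite eqxx.
    - by exists (last a ta); [rewrite !mem_cat mem_last | rewrite eS].
    - by exists q; [memb | rewrite eS].
    - by exists w => //; memb.
    - by case: (s2) ps2' => [|c l] /= /andP[cr _]; [exists b | exists c] => //; memb.
    - move=> x z xA zB; apply/negP => xz; rewrite mem_cat in xA; case/orP: xA => xA.
        by apply: (negP (NN x z xA _) xz); msplit zB; memb.
      have zD : z \in rcons tb b ++ rcons (r2 :: s2) b by msplit zB; memb.
      have [Q' EQ] := detour_last D xA zD xz.
      have xq : x = q by rewrite /q EQ last_rcons.
      rewrite mem_cat in zB; case/orP: zB => zB.
        by move/hasPn: Ht => /(_ z zB); rewrite -xq xz.
      have zr : z = r2.
        by apply: (one2 x z r2 xA) => //; [msplit zB; memb | memb | rewrite xq].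
      have [_ us _ _] := Is.
      move: us; have -> : a :: rcons (sa ++ v :: r2 :: s2) b = (a :: sa ++ [:: v]) ++ r2 :: rcons s2 b.
        by rewrite rcons_cat /= -catA.
      by rewrite cat_uniq /= -zr zB !andbF.
    - by memb.
    - apply/negP => M; apply: (DD a); first by memb.
      by msplit M; memb.
    - by apply/negP => M; msplit M; clash eS.
    - by apply/negP => M; msplit M; clash eS.
  apply: (IH _ _ _ _ (reroute_bottom R D pa Ea Ep Es Es' qr2)).
  apply: (cross_lt1 eS) uvX (cross_notin _ (us' _ _ Es) (vs' _ _ Es)) => x z xt zs xz.
  have [//|[xQ zb xq]] := cross_bottom R D pa Ea Ep Es s10 xt zs xz.
  by move/hasPn: Ht => /(_ z (mem_rconsl _ zb)); rewrite /q -xq xz.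
have [r1 r1t qr1] := hasP Ht.
(* The vertex [b] lies on both paths, so if [q] saw [b], it would have two neighbours on the path
   through [s]. *)
have {}r1t : r1 \in tb.
  move: r1t; rewrite mem_rcons inE => /orP[/eqP r1b|//].
  have br2 : b = r2 by apply: (one2 q b r2 qQ) => //; [memb | memb | rewrite -r1b].
  by exfalso; subst r2; clash_notin.
have [t1 [t2 Et]] := in_split r1t.
have Et' : r1 = head b (r1 :: t2) by [].
have [_ ut _ _] := It; have [_ us _ _] := Is.
have EuT : a :: rcons (ta ++ u :: tb) b = (a :: ta ++ u :: t1) ++ r1 :: rcons t2 b.
  by rewrite Et rcons_cat /= rcons_cat -catA.
have EuS : a :: rcons (sa ++ v :: sb) b = (a :: sa ++ v :: s1) ++ r2 :: rcons s2 b.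
  by rewrite Es rcons_cat /= rcons_cat -catA.
have [N3 D3] := ipath_sep It (nbr_cycle_nonadj triangle_free C) EuT.
have [N4 D4] := ipath_sep Is (nbr_cycle_nonadj triangle_free C) EuS.
(* A chord [fg] at a vertex of [t1] disappears together with [t1], which pays for the new chord from
   [q] to [r2]. A chord at [s1] likewise pays for the one from [q] to [r1] when the detour crosses
   over. *)
case H1: (has (fun f => has (e f) (sa ++ v :: sb)) t1).
  have [f ft1 /hasP[g gs fg]] := hasP H1.
  apply: (IH _ _ _ _ (reroute_top R D pa Ea Ep Et Et' qr1)).
  have ftb : f \in tb by rewrite Et; memb.
  apply: (cross_lt2 eS eI _ uvX _ (cross_notin _ (ut' _ _ Et) (vt' _ _ Et)) _ (f := f) (g := g)
    (m := q) (n := r2)).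
  - move=> x z xt zs xz; have [|[xQ zb xq]] := cross_top R D pa Ea Et xt zs xz; first by left.
    right; split=> //; apply: (one2 x z r2 xQ) => //; [memb | memb | by rewrite xq].
  - by apply: cross_in => //; memb.
  - apply: cross_notin; apply/negP => M; rewrite !mem_cat in M; case/or3P: M => M; try (move/spre: M => M).
    + by clash eS.
    + by apply: (QB f M); memb.
    + move: ut; rewrite EuT cat_uniq => /and3P[_ /hasPn/(_ f) + _].
      by move=> /(_ _)/negP; apply; [msplit M; memb | memb].
    + by apply: (ts g) => //; memb.
    + by msplit gs; clash eS.
    + by apply: (ts g) => //; rewrite Et; memb.
  - by apply/eqP => E; subst f; clash eS.
  - by apply/eqP => E; subst f; clash eS.
case H2: (has (fun g => has (e g) tb) s1).
  have [g gs1 /hasP[f ft gf]] := hasP H2.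
  have s10 : s1 <> [::] by move=> E; rewrite E in gs1.
  apply: (IH _ _ _ _ (reroute_bottom R D pa Ea Ep Es Es' qr2)).
  have gsb : g \in sb by rewrite Es; memb.
  apply: (cross_lt2 eS eI _ uvX _ (cross_notin _ (us' _ _ Es) (vs' _ _ Es)) _ (f := f) (g := g)
    (m := q) (n := r1)).
  - move=> x z xt zs xz; have [|[xQ zb xq]] := cross_bottom R D pa Ea Ep Es s10 xt zs xz; first by left.
    right; split=> //; apply: (one1 x z r1 xQ) => //; [memb | memb | by rewrite xq].
  - by apply: cross_in; rewrite 1?eS //; memb.
  - apply: cross_notin; apply/negP => M; rewrite !mem_cat in M; case/or3P: M => M; try (move/spre: M => M).
    + by clash eS.
    + by apply: (QB f M); memb.
    + by apply: (ts f); [memb | rewrite Es; memb].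
    + by apply: (ts g); memb.
    + by apply: (QB g M); memb.
    + move: us; rewrite EuS cat_uniq => /and3P[_ /hasPn/(_ g) + _].
      by move=> /(_ _)/negP; apply; [msplit M; memb | memb].
  - by apply/eqP => E; subst f; clash eS.
  - by apply/eqP => E; subst f; clash eS.
(* Now the segments from the chord up to [r1] and [r2], joined by [uv], are anticomplete to the
   segments after [r1] and [r2], joined at [b]; so [q] is a center. *)
exfalso.
have n1 : no_edge e t1 (sa ++ v :: sb).
  by move=> x z xt zs; move/hasPn: H1 => /(_ x xt)/hasPn/(_ z zs).
have n2 : no_edge e s1 tb.
  by move=> x z xt zs; move/hasPn: H2 => /(_ x xt)/hasPn/(_ z zs).
have sT w : w \in t2 -> w \in tb by move=> ?; rewrite Et; memb.
have sS w : w \in s2 -> w \in sb by move=> ?; rewrite Es; memb.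
have sT1 w : w \in t1 -> w \in tb by move=> ?; rewrite Et; memb.
have sS1 w : w \in s1 -> w \in sb by move=> ?; rewrite Es; memb.
move: (pt) (ps); rewrite Et Es !rcons_cat !cat_path /= !rcons_cat !cat_path /=.
move=> /and5P[_ _ pt1 ur1 pt2] /and5P[_ _ ps1 vr2 ps2].
apply: (@no_theta V e eS eI free q r1 r2 ((u :: t1) ++ v :: s1) (rcons t2 b ++ rcons s2 b) u) => //.
- by apply/eqP => E; subst r2; apply: (ts r1); memb.
- apply/negP => E; apply: (@triangle_free q r1 r2) => //; rewrite inE.
  + by rewrite QH ?orbT.
  + by rewrite tH ?orbT //; memb.
  + by rewrite sH ?orbT //; memb.
- by apply: (conn_cat eS (path_conn eS pt1) (path_conn eS ps1) (mem_head _ _) (mem_head _ _)); rewrite uv orbT.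
- apply: (conn_cat eS (path_conn_tail eS pt2) (path_conn_tail eS ps2) (mem_rconsr _ _) (mem_rconsr _ _)).
  by rewrite eqxx.
- by exists (last u t1); [rewrite mem_cat mem_last | rewrite eS].
- by exists (last v s1); [rewrite mem_cat mem_last orbT | rewrite eS].
- by case: (t2) pt2 => [|c l] /= /andP[cr _]; [exists b | exists c] => //; memb.
- by case: (s2) ps2 => [|c l] /= /andP[cr _]; [exists b | exists c] => //; memb.
- move=> x z xA zB; apply/negP => xz; rewrite mem_cat in xA; rewrite mem_cat in zB.
  case/orP: xA => xA; case/orP: zB => zB.
  + by apply: (negP (N3 x z _ zB) xz); msplit xA; memb.
  + move: xA zB; rewrite inE mem_rcons inE => /orP[/eqP xu|xA] /orP[/eqP zb|zB].
    * by subst x z; clash_edge eS.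
    * by subst x; move/sS: zB => zB; clash_edge eS.
    * by subst z; clash_edge eS.
    * by move/sS: zB => zB; clash_edge eS.
  + move: xA zB; rewrite inE mem_rcons inE => /orP[/eqP xu|xA] /orP[/eqP zb|zB].
    * by subst x z; clash_edge eS.
    * by subst x; move/sT: zB => zB; clash_edge eS.
    * by subst z; clash_edge eS.
    * by move/sT: zB => zB; clash_edge eS.
  + by apply: (negP (N4 x z _ zB) xz); msplit xA; memb.
- by memb.
- apply/negP => M; rewrite mem_cat !mem_rcons !inE in M; move: M u2 u4; rewrite !mem_rcons !inE !negb_or.
  move=> M /andP[u5 u6] /andP[_ u7]; move: M; rewrite (negPf u5) => /orP[/sT|/sS] M; clash eS.
- apply/negP => M; rewrite mem_cat !inE in M; case/orP: M => /orP[/eqP M|M].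
  + by rewrite M in qQ; clash eS.
  + by apply: (QB q) => //; move/sT1: M => M; memb.
  + by rewrite M in qQ; clash eS.
  + by apply: (QB q) => //; move/sS1: M => M; memb.
- apply/negP => M; apply: (QB q) => //; move: M; rewrite !(mem_cat, mem_rcons, inE) -orbA.
  by case/or4P=> [->|/sT ->|->|/sS ->]; rewrite ?orbT.
Qed.

End Bypass.

(** * The separating edge *)

Section Separating.
Variables (V : finType) (e : rel V).
Hypotheses (eS : symmetric e) (eI : irreflexive e).
Hypothesis free : ~ has_induced_propeller e.
Variables (y : V) (H : seq V).
Hypothesis yH : y \notin H.
Hypothesis triangle_free : forall x z w,
  x \in y :: H -> z \in y :: H -> w \in y :: H -> e x z -> e z w -> e x w -> False.

Notation nbr_cycle := (nbr_cycle e y H).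

Lemma path_rev x l z : path e x (rcons l z) -> path e z (rcons (rev l) x).
Proof.
move=> pl; have := rev_path e x (rcons l z); rewrite last_rcons belast_rcons rev_cons => ->.
by rewrite (eq_path (e' := e)).
Qed.

(** The cycle is recut at [c] in place of [a] or [b], chosen so that [f] joins the path of [g] or
    becomes an end, and [fg] no longer crosses. The part of the induced path that moves over to [s]
    is anticomplete to the part that stays, so no crossing chord is added. *)
Lemma center_off (G : Prop) a b t s f g c : nbr_cycle a b t s -> ipath e a t b ->
  f \in t -> g \in s -> e f g -> c \in t -> e y c ->
  (forall a b t' s', nbr_cycle a b t' s' -> #|cross e t' s'| < #|cross e t s| -> G) -> G.
Proof.
move=> C It ft gs fg ct yc IH; have [l1 [l2 E]] := in_split ct.
have [aH bH ab ya yb tH sH pt ps at' bt as' bs ts] := C; have [_ ut _ _] := It.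
have Ec : a :: rcons t b = (a :: l1) ++ c :: rcons l2 b by rewrite E rcons_cat.
have [N D] := ipath_sep It (nbr_cycle_nonadj triangle_free C) Ec.
have fgX := cross_in fg ft gs; have gt : g \notin t by apply/negP => gt; apply: (ts g).
have st1 w : w \in l1 -> w \in t by move=> wl; rewrite E; memb.
have st2 w : w \in l2 -> w \in t by move=> wl; rewrite E; memb.
move: ut; rewrite Ec cat_uniq /= negb_or => /and4P[_ /andP[c1 _] c2 _].
move: (pt); rewrite E rcons_cat cat_path /= => /and3P[pl1 lc pl2].
have p1 : path e a (rcons l1 c) by rewrite rcons_path pl1.
have cs : c \notin s by apply/negP => cs; apply: (ts c).
case: (boolP (f \in l1)) => f1.
- apply: (IH c b l2 (rev l1 ++ a :: s)).
  + constructor=> //; first exact: tH.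
    * by apply: contraNneq bt => <-.
    * by move=> w /st2 wt; apply: tH.
    * move=> w; rewrite mem_cat mem_rev inE => /or3P[/st1/tH //|/eqP->//|/sH //].
    * by rewrite rcons_cat cat_path; have := path_rev p1; rewrite rcons_path => /andP[-> ac] /=; rewrite ac.
    * by apply: contra c2 => wl; memb.
    * by apply/negP => M; move/st2: M => M; clash eS.
    * by rewrite mem_cat mem_rev inE (negPf cs) orbF; move: c1; rewrite inE orbC.
    * rewrite mem_cat mem_rev inE (negPf bs) orbF [b == a]eq_sym (negPf ab) orbF.
      by apply/negP => /st1 M; clash eS.
    * move=> w wl; rewrite mem_cat mem_rev inE => /or3P[w1|/eqP wa|ws].
      - by clash eS.
      - by subst w; move/st2: wl => M; clash eS.
      - by move/st2: wl => M; clash eS.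
  + apply: (cross_lt1 eS) fgX _.
    * move=> x z xt; rewrite mem_cat mem_rev inE => /or3P[zs|/eqP za|zs] xz; last by apply: cross_in; auto.
      - by clash_edge eS.
      - by subst z; clash_edge eS.
    * apply: cross_notin; first by apply/negP => f2; clash_mem.
      by apply: contra gt; apply: st2.
- apply: (IH a c l1 (s ++ b :: rev l2)).
  + constructor=> //; first exact: tH.
    * by apply: contraNneq at' => ->.
    * by move=> w /st1 wt; apply: tH.
    * move=> w; rewrite mem_cat inE mem_rev => /or3P[/sH //|/eqP->//|/st2/tH //].
    * move: ps; rewrite -cat_rcons rcons_cat cat_path => -> /=; rewrite last_rcons; exact: path_rev.
    * by apply/negP => M; move/st1: M => M; clash eS.
    * by apply: contra c1 => wl; memb.
    * rewrite mem_cat inE mem_rev (negPf as') (negPf ab) /=.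
      by apply/negP => /st2 M; clash eS.
    * by rewrite mem_cat inE mem_rev (negPf cs) /=; move: c2; rewrite mem_rcons inE.
    * move=> w wl; rewrite mem_cat inE mem_rev => /or3P[ws|/eqP wa|w1].
      - by move/st1: wl => M; clash eS.
      - by subst w; move/st1: wl => M; clash eS.
      - by clash eS.
  + apply: (cross_lt1 eS) fgX _.
    * move=> x z xt; rewrite mem_cat inE mem_rev => /or3P[zs|/eqP za|zs] xz; first by apply: cross_in; auto.
      - by subst z; clash_edge eS.
      - by clash_edge eS.
    * apply: cross_notin => //.
      by apply: contra gt; apply: st1.
Qed.

(* Exchange the tails of [t] and [s] along [uv] and a chord [u'v'] crossing it: the only
   possible new chords are [uu'] and [vv'], and if both are edges, then [u'] is a center. *)
Lemma uncross (G : Prop) a b ta u tb sa v sb :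
  nbr_cycle a b (ta ++ u :: tb) (sa ++ v :: sb) ->
  ipath e a (ta ++ u :: tb) b -> ipath e a (sa ++ v :: sb) b ->
  no_edge e [:: y] (ta ++ u :: tb) -> no_edge e [:: y] (sa ++ v :: sb) ->
  e u v -> no_edge e ta (sa ++ v :: sb) ->
  (forall a b t s, nbr_cycle a b t s ->
     #|cross e t s| < #|cross e (ta ++ u :: tb) (sa ++ v :: sb)| -> G) ->
  G \/ no_edge e sa (ta ++ u :: tb).
Proof.
move=> C It Is yt ys uv nta IH.
case X: (has (fun g => has (e g) (ta ++ u :: tb)) sa); last first.
  by right=> g f gs ft; move/hasPn: X => /(_ g gs)/hasPn/(_ f ft).
left; have [v' vs /hasP[u' ut vu]] := hasP X.
have ys' := ys; have yt' := yt.
have [[N1 D1 U1 U2] [u1 u2 u3 u4]] := chord_end eS eI free yH triangle_free C It Is ys uv.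
have vu0 : e v u by rewrite eS.
have [[N2 D2 U3 U4] [v1 v2 v3 v4]] := chord_end eS eI free yH triangle_free (nbr_cycleC C) Is It yt vu0.
have {}ut : u' \in tb.
  move: ut; rewrite mem_cat inE => /or3P[M|/eqP M|//]; first by clash_edge eS.
  by subst u'; clash_edge eS.
have [t1 [t2 Et]] := in_split ut; have [s1 [s2 Es]] := in_split vs.
subst tb sa.
have At : ta ++ u :: t1 ++ u' :: t2 = (ta ++ u :: t1) ++ u' :: t2 by rewrite -catA.
have As : (s1 ++ v' :: s2) ++ v :: sb = s1 ++ v' :: s2 ++ v :: sb by rewrite -catA.
have uv' : e u' v' by rewrite eS.
have [[N3 D3 U5 U6] [u5 u6 u7 u8]] : 
  [/\ no_edge e (a :: ta ++ u :: t1) (rcons t2 b), disj (a :: ta ++ u :: t1) (rcons t2 b),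
      no_edge e [:: u'] (a :: s1) & no_edge e [:: u'] (rcons (s2 ++ v :: sb) b)] /\
  [/\ u' \notin a :: ta ++ u :: t1, u' \notin rcons t2 b, u' \notin a :: s1
    & u' \notin rcons (s2 ++ v :: sb) b].
  move: C It Is ys uv'; rewrite At As => C It Is ys uv'.
  exact: (chord_end eS eI free yH triangle_free C It Is ys uv').
have [[N4 D4 U7 U8] [v5 v6 v7 v8]] : 
  [/\ no_edge e (a :: s1) (rcons (s2 ++ v :: sb) b), disj (a :: s1) (rcons (s2 ++ v :: sb) b),
      no_edge e [:: v'] (a :: ta ++ u :: t1) & no_edge e [:: v'] (rcons t2 b)] /\
  [/\ v' \notin a :: s1, v' \notin rcons (s2 ++ v :: sb) b, v' \notin a :: ta ++ u :: t1
    & v' \notin rcons t2 b].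
  move: (nbr_cycleC C) It Is yt vu; rewrite At As => C' It' Is' yt'' vu'.
  exact: (chord_end eS eI free yH triangle_free C' Is' It' yt'' vu').
have [aH bH ab ya yb tH sH pt ps at' bt as' bs ts] := C.
have nuu : e u u' -> t1 = [::].
  case: (t1) It => // c l It'; have [|N _] := @ipath_sep V e _ _ _ (a :: ta ++ [:: u]) c
    (l ++ u' :: rcons t2 b) It' (nbr_cycle_nonadj triangle_free C).
    by rewrite rcons_cat /= rcons_cat -catA.
  by move=> uu; exfalso; clash_edge eS.
have nvv : e v v' -> s2 = [::].
  case: (s2) Is => // c l Is'; have [|N _] := @ipath_sep V e _ _ _ (a :: s1 ++ [:: v']) c
    (l ++ v :: rcons sb b) Is' (nbr_cycle_nonadj triangle_free C).
    by rewrite !rcons_cat /= -!catA.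
  by move=> vv; exfalso; clash_edge eS.
move: (pt); rewrite rcons_cat /= rcons_cat cat_path /= cat_path /= => /and5P[pta au pt1 tu pt2].
move: (ps); rewrite As rcons_cat /= rcons_cat cat_path /= cat_path /= => /and5P[ps1 av ps2 sv psb].
have C' : nbr_cycle a b (ta ++ u :: v :: sb) (s1 ++ v' :: u' :: t2).
  constructor=> //.
  + by move=> w wt; msplit wt; [apply: tH | apply: tH | apply: sH | apply: sH]; memb.
  + by move=> w wt; msplit wt; [apply: sH | apply: sH | apply: tH | apply: tH]; memb.
  + by rewrite rcons_cat cat_path /= pta au uv psb.
  + by rewrite rcons_cat cat_path /= ps1 av vu pt2.
  + by apply/negP => M; msplit M; clash eS.
  + by apply/negP => M; msplit M; clash eS.
  + by apply/negP => M; msplit M; clash eS.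
  + by apply/negP => M; msplit M; clash eS.
  + by move=> x xt xs; msplit xt; msplit xs; clash eS.
have sub x z : x \in (ta ++ u :: v :: sb) -> z \in (s1 ++ v' :: u' :: t2) -> e x z ->
    [\/ (x, z) \in cross e (ta ++ u :: t1 ++ u' :: t2) ((s1 ++ v' :: s2) ++ v :: sb),
      [/\ e u u', x = u & z = u'] | [/\ e v v', x = v & z = v']].
  move=> xt zs xz; rewrite !mem_cat !inE in xt zs.
  case/or4P: xt => [xt|/eqP xt|/eqP xt|xt]; case/or4P: zs => [zs|/eqP zs|/eqP zs|zs];
    try (subst x); try (subst z);
    try by [clash_edge eS | constructor 2 | constructor 3].
  by constructor 1; rewrite cross_flip //; apply: cross_in; rewrite 1?eS //; memb.
have uvX : (u, v) \in cross e (ta ++ u :: t1 ++ u' :: t2) ((s1 ++ v' :: s2) ++ v :: sb).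
  by apply: cross_in => //; memb.
have nX : (u', v') \in cross e (ta ++ u :: t1 ++ u' :: t2) ((s1 ++ v' :: s2) ++ v :: sb).
  by apply: cross_in => //; memb.
have uvX' : (u, v) \notin cross e (ta ++ u :: v :: sb) (s1 ++ v' :: u' :: t2).
  by rewrite crossC; apply: cross_notin; apply/negP => M; msplit M; clash eS.
have nX' : (u', v') \notin cross e (ta ++ u :: v :: sb) (s1 ++ v' :: u' :: t2).
  by apply: cross_notin; apply/negP => M; msplit M; clash eS.
have finish m n : (forall x z, x \in (ta ++ u :: v :: sb) -> z \in (s1 ++ v' :: u' :: t2) -> e x z ->
    (x, z) \in cross e (ta ++ u :: t1 ++ u' :: t2) ((s1 ++ v' :: s2) ++ v :: sb) \/ x = m /\ z = n) -> G.
  move=> sub'; apply: (IH _ _ _ _ C'); apply: (cross_lt2 eS eI sub' uvX nX uvX' nX').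
  + by apply/eqP => E; subst u'; clash eS.
  + by apply/eqP => E; subst u'; clash eS.
case uu: (e u u'); case vv: (e v v').
(* Here [u] precedes [u'] and [v'] precedes [v] immediately. The neighbours [u] and [v'] of [u'] are
   joined by the single vertex [v] and by the way through [a]. *)
- exfalso; have {}nuu := nuu uu; have {}nvv := nvv vv; subst t1 s2.
  apply: (@no_theta V e eS eI free u' u v' [:: v] ((a :: ta) ++ a :: s1) v) => //.
  + by rewrite eS.
  + by apply/eqP => E; subst v'; clash eS.
  + by apply: U1; memb.
  + by apply: (@path_conn V e eS v [::]).
  + by apply: (conn_cat eS (path_conn eS pta) (path_conn eS ps1) (mem_head _ _) (mem_head _ _)); rewrite eqxx.
  + by exists v => //; memb.
  + by exists v; [memb | rewrite eS].
  + by exists (last a ta); [rewrite mem_cat mem_last | rewrite eS].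
  + by exists (last a s1); [rewrite mem_cat mem_last orbT | rewrite eS].
  + move=> x z; rewrite inE => /eqP-> zB; apply/negP => vz; msplit zB; clash_edge eS.
  + by memb.
  + by apply/negP => M; msplit M; clash eS.
  + by apply/negP => M; msplit M; clash eS.
  + by apply/negP => M; msplit M; clash eS.
- apply: (finish u u') => x z xt zs xz.
  by case: (sub x z xt zs xz) => [?|[_ ? ?]|[vv' _ _]]; [left | right | rewrite vv in vv'].
- apply: (finish v v') => x z xt zs xz.
  by case: (sub x z xt zs xz) => [?|[uu' _ _]|[_ ? ?]]; [left | rewrite uu in uu' | right].
- apply: (finish u u') => x z xt zs xz.
  by case: (sub x z xt zs xz) => [?|[uu' _ _]|[vv' _ _]]; [left | rewrite uu in uu' | rewrite vv in vv'].
Qed.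

Definition edge_separated : Prop :=
  exists a' b' u v, [/\ [/\ a' \in H, b' \in H, e y a' & e y b'],
    [/\ u \in H, v \in H & e u v],
    [/\ a' != u, a' != v, b' != u & b' != v] &
    ~~ connect (avoid e H u v) a' b'].

(** Strong induction on the number of crossing chords replaces the choice of a cycle with the
    fewest; [red] makes one path induced without adding any. *)
Lemma separating_edge n a b t s : nbr_cycle a b t s -> #|cross e t s| < n -> edge_separated.
Proof.
elim: n a b t s => // n IHn a b t s C0 le_n.
have red a0 b0 t0 s0 : nbr_cycle a0 b0 t0 s0 ->
    exists t1, [/\ {subset t1 <= t0}, ipath e a0 t1 b0 & nbr_cycle a0 b0 t1 s0].
  move=> C; have [aH bH ab ya yb tH sH pt ps at' bt as' bs ts] := C.
  have t00 : t0 <> [::].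
    by move=> E; move: pt (nbr_cycle_nonadj triangle_free C); rewrite E /= andbT => ->.
  have [cT aT bT] := walk_conn eS pt t00.
  have [t1 t1t It] := conn_ipath eS cT at' bt ab aT bT.
  have [pt1 _ _ _] := It; exists t1; split=> //; constructor=> //.
  - by move=> w /t1t/tH.
  - by apply: contra at' => /t1t.
  - by apply: contra bt => /t1t.
  - by move=> x /t1t; apply: ts.
have cross_sub t0 s0 t1 : {subset t1 <= t0} -> #|cross e t1 s0| <= #|cross e t0 s0|.
  move=> sub; apply: subset_leq_card; apply/subsetP => -[x z]; rewrite !inE /=.
  by case/andP=> -> /orP[]/andP[x1 x2]; rewrite ?(sub _ x1) ?(sub _ x2) ?x1 ?x2 ?orbT.
have [t1 [sub1 It C1]] := red _ _ _ _ C0; have [s1 [sub2 Is C2]] := red _ _ _ _ (nbr_cycleC C1).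
have {}C2 := nbr_cycleC C2.
have le1 : #|cross e t1 s1| < n.+1.
  apply: leq_ltn_trans le_n; apply: leq_trans (cross_sub _ _ _ sub1).
  by rewrite [cross e t1 s1]crossC [cross e t1 s]crossC; apply: cross_sub.
have IH a0 b0 t0 s0 : nbr_cycle a0 b0 t0 s0 -> #|cross e t0 s0| < #|cross e t1 s1| -> edge_separated.
  by move=> C lt; apply: (IHn _ _ _ _ C); apply: leq_trans lt _.
move: C2 It Is IH => {le1 sub1 sub2 C1 C0 cross_sub red le_n IHn s t}.
move: t1 s1 => t s C It Is IH.
have [aH bH ab ya yb tH sH pt ps at' bt as' bs ts] := C.
case X: (has (fun x => has (e x) s) t); last first.
  have [_ _ t0 _] := It; have [_ _ s0 _] := Is.
  have [cT aT bT] := walk_conn eS pt t0; have [cS aS bS] := walk_conn eS ps s0.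
  case: t t0 {It IH C} pt tH at' bt ts X cT aT bT => // c t _ pt tH at' bt ts X cT aT bT.
  exfalso; apply: (@no_theta V e eS eI free y a b (c :: t) s c) => //.
  - apply/negP => E; apply: (@triangle_free y a b) => //; by rewrite inE ?eqxx ?aH ?bH ?orbT.
  - by move=> x z xt zs; move/hasPn: X => /(_ x xt)/hasPn/(_ z zs).
  - by memb.
  - by apply/negP => M; apply: (ts c) => //; memb.
  - by apply: contra yH; apply: tH.
  - by apply: contra yH; apply: sH.
have [f ft /hasP[g gs fg]] := hasP X.
case Yt: (has (e y) t).
  by have [c ct yc] := hasP Yt; apply: (center_off C It ft gs fg ct yc IH).
case Ys: (has (e y) s).
  have [c ct yc] := hasP Ys; have gf : e g f by rewrite eS.
  apply: (center_off (nbr_cycleC C) Is gs ft gf ct yc) => a0 b0 t0 s0 C'.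
  by rewrite [cross e s t]crossC; apply: (IH _ _ _ _ C').
have yt : no_edge e [:: y] t by move=> w z; rewrite inE => /eqP-> zt; move/hasPn: Yt => /(_ z zt).
have ys : no_edge e [:: y] s by move=> w z; rewrite inE => /eqP-> zt; move/hasPn: Ys => /(_ z zt).
(* The vertex [u] is the first one of [t] with a neighbour in [s], and [v] is any such neighbour;
   [uncross] then lowers the count or shows that no chord starts before [v] on [s]. *)
have [ta [u [tb [Et us nta]]]] : exists ta u tb, [/\ t = ta ++ u :: tb, has (e u) s & ~~ has (fun x => has (e x) s) ta].
  move: X; clear; elim: t => //= x t IH; case xs: (has (e x) s) => /=.
    by exists [::], x, t.
  by move/IH=> [ta [u [tb [-> us nta]]]]; exists (x :: ta), u, tb; rewrite /= xs.
have {}nta : no_edge e ta s by move=> x z xt zs; move/hasPn: nta => /(_ x xt)/hasPn/(_ z zs).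
have [v vs uv] := hasP us; have [sa [sb Es]] := in_split vs; subst t s.
have [//|nsa] := uncross C It Is yt ys uv nta IH.
have R : rung e y H a b ta u tb sa v sb by constructor.
case K: (connect (avoid e H u v) a b).
  have [Q [p [r D]]] := detour_exists eS eI free yH triangle_free R K.
  have pA := det_p D; rewrite mem_cat in pA; case/orP: pA => pA.
    exact: (bypass eS eI free yH triangle_free R D pA IH).
  apply: (bypass eS eI free yH triangle_free (rungC eS R) (detourC D) pA) => a0 b0 t0 s0 C'.
  by rewrite [cross e (sa ++ _) _]crossC; apply: (IH _ _ _ _ C').
exists a, b, u, v; rewrite K; split=> //; split=> //.
- by apply: tH; memb.
- by apply: sH; memb.
- by apply/eqP => E; subst a; clash_notin.
- by apply/eqP => E; subst a; clash_notin.
- by apply/eqP => E; subst b; clash_notin.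
- by apply/eqP => E; subst b; clash_notin.
Qed.

End Separating.

(** * Two disjoint paths *)

Section Main.
Variables (V : finType) (e : rel V).
Hypotheses (eS : symmetric e) (eI : irreflexive e).
Hypothesis free : ~ has_induced_propeller e.

Lemma avoid_sym (H : seq V) c d : connect_sym (avoid e H c d).
Proof. by apply: sym_connect_sym => x z; rewrite /avoid /= eS [(x \in _) && _]andbC. Qed.

Lemma avoid1 (H : seq V) c d x z : x \in H -> z \in H -> x != c -> x != d -> z != c -> z != d ->
  e x z -> connect (avoid e H c d) x z.
Proof.
by move=> xH zH xc xd zc zd xz; apply: connect1; rewrite /avoid /= !mem_filter xz xH zH xc xd zc zd.
Qed.

Lemma avoid_path (H : seq V) c d x l : path (avoid e H c d) x l ->
  path e x l /\ (forall z, z \in l -> [/\ z \in H, z != c & z != d]).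
Proof.
elim: l x => //= y l IH x /andP[/and3P[xy _]]; rewrite mem_filter => /andP[/andP[yc yd] yH] /IH[pl sl].
split; first by rewrite xy.
by move=> z; rewrite inE => /orP[/eqP->|/sl].
Qed.

Definition two_paths (H : seq V) a b := exists t s,
  [/\ path e a (rcons t b), path e a (rcons s b), uniq (a :: rcons t b),
      uniq (a :: rcons s b) & disj t s] /\ {subset t <= H} /\ {subset s <= H}.

Lemma two_pathsC a b t s : [/\ path e a (rcons t b), path e a (rcons s b), uniq (a :: rcons t b),
      uniq (a :: rcons s b) & disj t s] -> [/\ path e a (rcons s b), path e a (rcons t b),
      uniq (a :: rcons s b), uniq (a :: rcons t b) & disj s t].
Proof. by case=> ? ? ? ? D; split=> // x xs xt; apply: (D x). Qed.

(** The two-path case of Menger's theorem, by induction along a given path. From its second vertex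
    [x] there are two paths to [b]. A path from [a] to [b] avoiding [x] is followed until it first
    meets them, at [w]; it replaces one of them up to [w], while the edge [ax] extends the other. *)
Lemma no_cutvertex_two_paths H b l a : path e a l -> last a l = b -> uniq (a :: l) ->
  {subset a :: l <= H} -> a != b ->
  (forall c, c \in H -> c != a -> c != b -> connect (avoid e H c c) a b) -> two_paths H a b.
Proof.
elim: l a => [|x l IH] a; first by move=> _ /= -> _ _; rewrite eqxx.
move=> /= /andP[ax pl] lb /and3P[]; rewrite inE negb_or => /andP[nax al] xl ul sH ab nocut.
case: (eqVneq x b) => [xb|xb].
  exists [::], [::]; rewrite -xb /= inE nax ax; by split.
have xH : x \in H by apply: sH; memb.
have aH : a \in H by apply: sH; memb.
have lH : {subset x :: l <= H} by move=> w wl; apply: sH; memb.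
have [||t [s [ts [tH sH']]]] := IH x pl lb _ lH xb _; first by rewrite /= xl.
  (* Deleting [a] does not separate [x] from [b], because the tail [l] of the given path avoids
     [a]. *)
  move=> c cH cx cb; case: (eqVneq c a) => [->|ca].
    apply/connectP; exists l => //; have xna : x != a by rewrite eq_sym.
    clear -pl lH al xna; elim: l x pl lH al xna => //= z l IH x /andP[xz pl] lH.
    rewrite inE negb_or => /andP[az al] xa; rewrite eq_sym in az.
    rewrite IH // ?andbT; last by move=> w wl; apply: lH; memb.
    by rewrite /avoid /= xz !mem_filter xa az !lH //; memb.
  apply: connect_trans (nocut c cH ca cb); apply: avoid1 => //; rewrite 1?eq_sym // eS //.
have := nocut x xH; rewrite [x == a]eq_sym nax xb => /(_ isT isT) /connectP[m0 pm0].
case/shortenP: pm0 => m pm um _ mb {m0}.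
have [{}pm sm] := avoid_path pm.
have bm : b \in m.
  by move: (mem_last a m); rewrite -mb inE => /orP[/eqP E|//]; rewrite E eqxx in ab.
have hB : has (mem (b :: t ++ s)) m by apply/hasP; exists b => //; apply: mem_head.
case/split_find: hB pm um sm => w m1 m2 wB nm1 pm um sm {mb bm}.
move: pm; rewrite cat_path => /andP[pm _].
move: um; rewrite /= mem_cat negb_or cat_uniq -andbA => /and4P[am _ um _].
have m1B z : z \in m1 -> z \notin b :: t ++ s by move=> zm; move/hasPn: nm1 => /(_ z zm).
have m1x z : z \in m1 -> z != x by move=> zm; have [] := sm z; rewrite // mem_cat mem_rcons inE zm orbT.
have m1H z : z \in m1 -> z \in H by move=> zm; have [] := sm z; rewrite // mem_cat mem_rcons inE zm orbT.
have am1 : a \notin m1 by apply: contra am => am1; memb.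
have um1 : uniq m1 by move: um; rewrite rcons_uniq => /andP[].
(* If [a] itself lies on one of the two paths from [x], the tail of that path from [a] on is the
   first path wanted. *)
have key1 t' s' : [/\ path e x (rcons t' b), path e x (rcons s' b), uniq (x :: rcons t' b),
      uniq (x :: rcons s' b) & disj t' s'] -> {subset t' <= H} -> {subset s' <= H} ->
    a \in t' -> two_paths H a b.
  move=> [pt ps ut us ts'] tH1 sH1 at'.
  have as' : a \notin s' by apply/negP => as'; apply: (ts' a).
  have [t1 [t2 E]] := in_split at'; exists t2, (x :: s'); subst t'.
  move: pt ut; rewrite rcons_cat cat_path /= => /and3P[_ _ pt2].
  rewrite mem_cat negb_or inE negb_or cat_uniq => /andP[/and3P[_ _ xt2] /and3P[_ _ ut2]].
  split; [split=> //=|split].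
  - by rewrite ax ps.
  - by rewrite inE negb_or nax mem_rcons inE negb_or ab as'.
  - move=> z zt zs; rewrite inE in zs; case/orP: zs => [/eqP zx|zs].
      by subst z; move/negP: xt2; apply; memb.
    by apply: (ts' z) => //; memb.
  - by move=> z zt; apply: tH1; memb.
  - by move=> z; rewrite inE => /orP[/eqP->|/sH1].
have key2 t' s' : [/\ path e x (rcons t' b), path e x (rcons s' b), uniq (x :: rcons t' b),
      uniq (x :: rcons s' b) & disj t' s'] -> {subset t' <= H} -> {subset s' <= H} ->
    (forall z, z \in m1 -> z \notin t' ++ s') -> a \notin t' -> a \notin s' -> w \in t' ->
    two_paths H a b.
  move=> [pt ps ut us ts'] tH1 sH1 m1ts at' as' wt'.
  have [t1 [t2 E]] := in_split wt'; subst t'.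
  exists (m1 ++ w :: t2), (x :: s').
  move: pt ut; rewrite rcons_cat cat_path /= => /and3P[_ _ pt2].
  rewrite mem_cat negb_or inE negb_or cat_uniq => /andP[/and3P[_ xw xt2] /and3P[_ _ /= /andP[wt2 ut2]]].
  split; [split=> //=|split].
  - by rewrite -cat_rcons rcons_cat cat_path pm last_rcons.
  - by rewrite ax ps.
  - rewrite -cat_rcons rcons_cat mem_cat negb_or am /= cat_uniq um ut2 /= andbT.
    rewrite mem_rcons inE negb_or ab /= (contra _ at'); last by move=> M; memb.
    apply/hasPn => z zt; rewrite /= mem_rcons inE negb_or; apply/andP; split.
      by apply: contraNneq wt2 => <-.
    apply/negP => zm; rewrite mem_rcons inE in zt; case/orP: zt => [/eqP zb|zt].
      by move: (m1B z zm); rewrite zb mem_head.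
    by move/negP: (m1ts z zm); apply; memb.
  - by rewrite inE negb_or nax mem_rcons inE negb_or ab as'.
  - move=> z; rewrite mem_cat inE => zt zs; case/or3P: zt => zt.
    + rewrite inE (negPf (m1x z zt)) /= in zs.
      by move/negP: (m1ts z zt); apply; memb.
    + move/eqP: zt => zt; subst z; move: zs; rewrite inE eq_sym (negPf xw) /= => zs.
      by apply: (ts' w).
    + rewrite inE in zs; case/orP: zs => [/eqP zx|zs].
        by subst z; move/negP: xt2; apply; memb.
      by apply: (ts' z) => //; memb.
  - move=> z; rewrite mem_cat => /orP[/m1H //|zt]; apply: tH1; memb.
  - by move=> z; rewrite inE => /orP[/eqP->|/sH1].
case: (boolP (a \in t)) => [|at']; first exact: (key1 t s).
case: (boolP (a \in s)) => [|as']; first exact: (key1 s t (two_pathsC ts)).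
have m1ts z : z \in m1 -> z \notin t ++ s.
  by move/m1B; apply: contra => M; memb.
have m1st z : z \in m1 -> z \notin s ++ t.
  by move/m1B; apply: contra => M; msplit M; memb.
have : w \in b :: t ++ s by []; rewrite inE mem_cat => /or3P[/eqP wb|wt|ws]; last 2 first.
- exact: (key2 t s).
- exact: (key2 s t (two_pathsC ts)).
have [_ ps _ us _] := ts; exists m1, (x :: s); subst w; split; [split=> //=|split].
- by rewrite ax ps.
- by rewrite am um.
- by rewrite inE negb_or nax mem_rcons inE negb_or ab as'.
- move=> z zm; rewrite inE (negPf (m1x z zm)) /= => zs.
  by move/negP: (m1ts z zm); apply; memb.
- by [].
- by move=> z; rewrite inE => /orP[/eqP->|/sH'].
Qed.

(** * Boundaries and components *)

Definition boundary (W X : {set V}) := [set z in W | (z \notin X) && [exists x in X, e x z]].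

Lemma boundaryP (W X : {set V}) z x : z \in W -> z \notin X -> x \in X -> e x z -> z \in boundary W X.
Proof. by move=> zW zX xX xz; rewrite inE zW zX; apply/existsP; exists x; rewrite xX. Qed.

Lemma boundaryE (W X : {set V}) z : z \in boundary W X ->
  [/\ z \in W, z \notin X & exists2 x, x \in X & e x z].
Proof. by rewrite inE => /and3P[zW zX /exists_inP]. Qed.

Definition component (W S : {set V}) x : {set V} :=
  [set z | connect [rel u v | [&& e u v, u \in W :\: S & v \in W :\: S]] x z].

Lemma component_sub (W S : {set V}) x : x \in W :\: S -> component W S x \subset W :\: S.
Proof.
move=> xW; apply/subsetP => z; rewrite inE => /connectP[l pl ->] {z}.
elim: l x xW pl => //= y l IH x xW /andP[/and3P[_ _ yW]]; exact: IH.
Qed.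

Lemma component_closed (W S : {set V}) x u v : x \in W :\: S -> u \in component W S x ->
  v \in W :\: S -> e u v -> v \in component W S x.
Proof.
move=> xW uC vW uv; have uW := subsetP (component_sub xW) u uC.
move: uC; rewrite !inE => uC; apply: connect_trans uC _; apply: connect1 => /=.
by rewrite uv uW vW.
Qed.

Lemma component_conn (W S : {set V}) x : conn e (enum (component W S x)).
Proof.
set R := [rel u v | [&& e u v, u \in W :\: S & v \in W :\: S]].
have sR : connect_sym R.
  by apply: sym_connect_sym => u v; rewrite /R /= eS [(u \in _) && _]andbC.
pose R' := [rel u v | [&& e u v, u \in enum (component W S x) & v \in enum (component W S x)]].
have go' l u : u \in component W S x -> path R u l -> connect R' u (last u l).
  elim: l u => [|y l IH] u uC /=; first by rewrite connect0.
  case/andP=> Ruy pl; have yC : y \in component W S x.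
    by move: uC; rewrite inE => uC; rewrite inE; apply: connect_trans uC _; apply: connect1.
  apply: connect_trans (IH y yC pl); apply: connect1; rewrite /R' /= !mem_enum uC yC.
  by case/and3P: Ruy => ->.
have go z : z \in component W S x -> connect R' x z.
  by rewrite inE => /connectP[l pl ->]; apply: go' pl; rewrite inE connect0.
have sR' : connect_sym R'.
  by apply: sym_connect_sym => u v; rewrite /R' /= eS [(u \in _) && _]andbC.
move=> u v; rewrite !mem_enum => uC vC; apply: connect_trans (go v vC).
by rewrite -/R' sR'; apply: go.
Qed.


End Main.

(** * Vertices of low degree *)

Section LowDegree.
Variables (V : finType) (e : rel V).
Hypotheses (eS : symmetric e) (eI : irreflexive e).
Hypothesis free : ~ has_induced_propeller e.
Variable W : {set V}.
Hypothesis deg3 : forall v, v \in W -> 2 < #|[set w in W | e v w]|.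

Notation bd := (boundary e W).

Lemma third_neighbor y x z : y \in W -> exists y', [/\ y' \in W, e y y', y' != x & y' != z].
Proof.
move=> yW; have /subsetPn[y' y'N y'xz] : ~~ ([set w in W | e y w] \subset [set x; z]).
  apply/negP => /subset_leq_card; rewrite leqNgt => /negP; apply.
  by apply: leq_trans (deg3 yW); rewrite cards2; case: (_ != _).
move: y'N y'xz; rewrite !inE negb_or => /andP[y'W yy'] /andP[y'x y'z].
by exists y'.
Qed.

(** The components found at the corners [y] and [z] each contain a boundary vertex of [X], hence the
    same one, so they coincide; but the component at [y] has no edge to [z]. The corner [x] may be
    the boundary vertex of [X], so it is only placed in [W]. *)
Lemma no_triangle (X : {set V}) x y z :
  (forall Y : {set V}, Y \proper X -> Y != set0 -> #|bd Y| <= 1 -> False) ->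
  X \subset W -> #|bd X| <= 1 -> x \in W -> y \in X -> z \in X ->
  e x y -> e y z -> e x z -> False.
Proof.
move=> min XW bX xW yX zX xy yz xz.
have yW := subsetP XW y yX; have zW := subsetP XW z zX.
pose S := [set x; y; z].
have outS w : w \in W :\: S -> [/\ w \in W, w != x, w != y & w != z].
  by rewrite !inE !negb_or -!andbA => /and4P[-> -> -> ->].
have ne u v : e u v -> u != v by move=> uv; apply/eqP => E; rewrite E eI in uv.
(* The component of a further neighbour of [p] misses the other corners of the
   triangle [p q r], so its boundary is at most [p]; minimality puts the boundary of
   [X] into it. *)
have far p q r : [set p; q; r] = S -> p \in X -> e p q -> e p r -> e q r ->
    exists p' c, [/\ p' \in W :\: S, e p p', c \in bd X & c \in component e W S p'] /\
      no_edge e [:: q; r] (enum (component e W S p')).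
  move=> ES pX pq pr qr; have pW := subsetP XW p pX.
  have inS' w : w \in W -> w != p -> w != q -> w != r -> w \in W :\: S.
    by move=> wW wx wy wz; rewrite -ES !inE (negPf wx) (negPf wy) (negPf wz).
  have outS' w : w \in W :\: S -> [/\ w \in W, w != p, w != q & w != r].
    by rewrite -ES !inE !negb_or -!andbA => /and4P[-> -> -> ->].
  have [p' [p'W pp' p'q p'r]] := third_neighbor q r pW.
  have p'S : p' \in W :\: S by apply: inS' => //; rewrite eq_sym ne.
  have sub := component_sub e p'S.
  have p'C : p' \in component e W S p' by rewrite inE connect0.
  have cC : conn e (enum (component e W S p')) by apply: component_conn.
  have notin w : w \in S -> w \notin enum (component e W S p').
    by move=> wS; rewrite mem_enum; apply/negP => /(subsetP sub); rewrite inE wS.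
  have [pS qS rS] : [/\ p \in S, q \in S & r \in S] by rewrite -ES !inE !eqxx !orbT.
  have att : attached e p (enum (component e W S p')) by exists p'; rewrite ?mem_enum.
  have NE : no_edge e [:: q; r] (enum (component e W S p')).
    move=> w c wqr cC'; apply/negP => wc; have attw : attached e w (enum (component e W S p')) by exists c.
    move: wqr; rewrite !inE => /orP[]/eqP wE; subst w.
    - by apply: (@no_triangle_path V e eS eI free r p q _ _ _ pq cC att attw) => //; rewrite 1?eS // notin.
    - by apply: (@no_triangle_path V e eS eI free q p r _ _ _ pr cC att attw) => //; rewrite 1?eS // notin.
  exists p'.
  have [c cB cC'] : exists2 c, c \in bd X & c \in component e W S p'.
    apply/exists_inP; rewrite -[X in is_true X]negbK negb_exists_in; apply/negP => /forall_inP nb.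
    have p'X : p' \in X.
      apply/negPn/negP => p'X; have := nb p' (boundaryP p'W p'X pX pp').
      by rewrite p'C.
    have CX : component e W S p' \subset X.
      have go l u : u \in X -> u \in component e W S p' ->
          path [rel u v | [&& e u v, u \in W :\: S & v \in W :\: S]] u l -> last u l \in X.
        elim: l u => //= w l IH u uX uC /andP[/and3P[uw uS wS] pl].
        have wC := component_closed p'S uC wS uw.
        apply: IH => //; apply/negPn/negP => wX.
        by have [wW _ _ _] := outS w wS; have := nb w (boundaryP wW wX uX uw); rewrite wC.
      by apply/subsetP => z'; rewrite inE => /connectP[l pl ->] {z'}; apply: go pl.
    apply: (min (component e W S p')).
    - apply/properP; split=> //; exists p => //; move: (notin p pS); by rewrite mem_enum.
    - by apply/set0Pn; exists p'.
    - rewrite -(cards1 p); apply: subset_leq_card; apply/subsetP => w.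
      move=> /boundaryE[wW wC [u uC uw]]; rewrite inE; apply/negPn/negP => wp; have wq : w != q.
        by apply/eqP => wE; subst w; move: (NE q u); rewrite !inE eqxx mem_enum uC eS uw => /(_ isT isT).
      have wr : w != r.
        by apply/eqP => wE; subst w; move: (NE r u); rewrite !inE eqxx orbT mem_enum uC eS uw => /(_ isT isT).
      by move/negP: wC; apply; apply: component_closed uC _ uw => //; apply: inS'.
  by exists c.
have yx : e y x by rewrite eS. have zx : e z x by rewrite eS. have zy : e z y by rewrite eS.
have E1 : [set y; x; z] = S by apply/setP => w; rewrite !inE [(w == y) || _]orbC.
have E2 : [set z; x; y] = S by apply/setP => w; rewrite !inE -orbA orbC.
have [y' [c [[y'S yy' cX cy'] NEy]]] := far y x z E1 yX yx yz xz.
have [z' [c' [[z'S zz' cX' cz'] NEz]]] := far z x y E2 zX zx zy xy.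
have cc : c = c'.
  by apply: (card_le1_eqP bX).
subst c'.
have sR : connect_sym [rel u v | [&& e u v, u \in W :\: S & v \in W :\: S]].
  by apply: sym_connect_sym => u v /=; rewrite eS [(u \in _) && _]andbC.
have z'y' : z' \in component e W S y'.
  by move: cy' cz'; rewrite inE => cy'; rewrite inE sR => cz'; rewrite inE; apply: connect_trans cy' cz'.
by move: (NEy z z'); rewrite !inE eqxx orbT mem_enum z'y' zz' => /(_ isT isT).
Qed.

Lemma boundary_remove (Y : {set V}) z : bd (Y :\ z) \subset z |: bd Y.
Proof.
apply/subsetP => w /boundaryE[wW wY [x /setD1P[_ xY] xw]]; rewrite in_setU1.
case: (eqVneq w z) => //= wz; apply: boundaryP xY xw => //.
by apply: contra wY => wY; rewrite in_setD1 wz.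
Qed.

(** Being equal or adjacent, [u] and [v] cannot meet both the component of [a] and that of [b]. A
    component missing both lies in [Y] and has its boundary among [c], [d], [w], against [min]. The
    last premise provides a vertex of [Y] outside that component. *)
Lemma no_cut (K Y : {set V}) u v w a b c d :
  (forall Z : {set V}, Z \proper Y -> Z != set0 -> forall u v w, u \in K -> v \in K -> w \in K ->
     (u == v) || e u v -> bd Z \subset [set u; v; w] -> False) ->
  Y \subset W -> K \subset W -> Y \subset K -> u \in K -> v \in K -> w \in K ->
  (u == v) || e u v -> bd Y \subset [set u; v; w] -> (c == d) || e c d ->
  let H := enum (Y :|: [set u; v]) in
  a \in H -> b \in H -> c \in K -> d \in K -> a != c -> a != d -> b != c -> b != d ->
  (a \in Y) && (b \in Y) || [&& c != d, c \in H & d \in H] -> connect (avoid e H c d) a b.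
Proof.
move=> min YW KW YK uK vK wK uv bY cd H aH bH cK dK ac ad bc bd' abcd.
apply/negPn/negP => nab.
have inH x : (x \in H) = [|| x \in Y, x == u | x == v] by rewrite mem_enum !inE.
have HK x : x \in H -> x \in K by rewrite inH => /or3P[/(subsetP YK)|/eqP->|/eqP->].
have inM x : x \in H -> x != c -> x != d -> x \in [seq w <- H | (w != c) && (w != d)].
  by move=> xH xc xd; rewrite mem_filter xc xd.
pose C x := [set z | connect (avoid e H c d) x z].
have CM x z : x \in [seq w <- H | (w != c) && (w != d)] -> z \in C x ->
    z \in [seq w <- H | (w != c) && (w != d)].
  rewrite inE => + /connectP[l pl ->]; elim: l x pl => //= y l IH x /andP[/and3P[_ _ yM] pl] _.
  exact: IH.
have Cstep x z z' : x \in [seq w <- H | (w != c) && (w != d)] -> z \in C x ->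
    z' \in [seq w <- H | (w != c) && (w != d)] -> e z z' -> z' \in C x.
  move=> xM zC z'M zz'; have zM := CM x z xM zC; move: zC; rewrite inE => zC; rewrite inE.
  by apply: connect_trans zC _; apply: connect1; rewrite /avoid /= zz' zM z'M.
have one x x' : x \in H -> x != c -> x != d -> x' \in H -> x' != c -> x' != d ->
    (x \in Y) && (x' \in Y) || [&& c != d, c \in H & d \in H] -> x' \notin C x -> u \notin C x -> v \notin C x -> False.
  move=> xH xc xd xH' xc' xd' Yxx nx' nu nv; have xM := inM x xH xc xd.
  have CY z : z \in C x -> z \in Y.
    move=> zC; have := CM x z xM zC; rewrite mem_filter inH => /andP[_ /or3P[//|/eqP zu|/eqP zv]].
      by move: nu; rewrite -zu zC.
    by move: nv; rewrite -zv zC.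
  apply: (min (C x) _ _ c d w cK dK wK cd).
  - apply/properP; split; first by apply/subsetP => z /CY.
    have nc : c \notin C x by apply/negP => /(CM x c xM); rewrite mem_filter eqxx.
    have nd : d \notin C x by apply/negP => /(CM x d xM); rewrite mem_filter eqxx andbF.
    case/orP: Yxx => [/andP[_ x'Y]|/and3P[ncd cH dH]]; first by exists x'.
    case cY: (c \in Y); first by exists c.
    case dY: (d \in Y); first by exists d.
    case x'Y: (x' \in Y); first by exists x'.
    (* Otherwise the three distinct vertices [c], [d] and [x'] would all be among [u] and [v]. *)
    exfalso; move: cH dH xH' ncd xc' xd'; rewrite !inH cY dY x'Y /=.
    by do 3 case/orP=> /eqP->; rewrite ?eqxx // => *; rewrite ?eqxx in *.
  - by apply/set0Pn; exists x; rewrite inE connect0.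
  - apply/subsetP => z /boundaryE[zW zC [y yC yz]]; rewrite !inE -orbA.
    case: (eqVneq z c) => //= zc; case: (eqVneq z d) => //= zd.
    apply/negPn/negP => zw; move/negP: zC; apply; apply: (Cstep x y z) => //.
    apply: inM => //; rewrite inH; case zY: (z \in Y) => //=.
    have : z \in bd Y by apply: boundaryP (CY y yC) yz; rewrite ?zY.
    by move/(subsetP bY); rewrite !inE (negPf zw) orbF.
have sym := avoid_sym eS H c d.
have nba : a \notin C b by rewrite inE sym.
have nab' : b \notin C a by rewrite inE.
have aM := inM a aH ac ad; have bM := inM b bH bc bd'.
have abcd' : (b \in Y) && (a \in Y) || [&& c != d, c \in H & d \in H] by rewrite [(b \in Y) && _]andbC.
have [r [rC ruv]] : exists r, r \in C a /\ (r == u) || (r == v).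
  case ua: (u \in C a); first by exists u; rewrite ua eqxx.
  case va: (v \in C a); first by exists v; rewrite va eqxx orbT.
  by case: (one a b) => //; rewrite ?ua ?va.
have [q [qC quv]] : exists q, q \in C b /\ (q == u) || (q == v).
  case ua: (u \in C b); first by exists u; rewrite ua eqxx.
  case va: (v \in C b); first by exists v; rewrite va eqxx orbT.
  by case: (one b a) => //; rewrite ?ua ?va.
have rq : (r == q) || e r q.
  case/orP: ruv => /eqP->; case/orP: quv => /eqP->; rewrite ?eqxx //.
  by case/orP: uv => [/eqP->|vu]; rewrite ?eqxx // eS vu orbT.
have qCa : q \in C a.
  case/orP: rq => [/eqP<-//|rq]; apply: (Cstep a r) => //; exact: CM bM qC.
move/negP: nab; apply; move: qC qCa; rewrite inE sym => qb; rewrite inE => aq.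
exact: connect_trans aq qb.
Qed.

Lemma no_fragment n (K Y : {set V}) u v w :
  (forall x z t, x \in K -> z \in K -> t \in K -> e x z -> e z t -> e x t -> False) ->
  K \subset W -> #|Y| < n -> Y \subset K -> Y != set0 -> u \in K -> v \in K -> w \in K ->
  (u == v) || e u v -> bd Y \subset [set u; v; w] -> False.
Proof.
move=> tri KW; elim: n Y u v w => // n IH Y u v w Yn YK Y0 uK vK wK uv bY.
have min (Z : {set V}) : Z \proper Y -> Z != set0 -> forall u v w, u \in K -> v \in K -> w \in K ->
     (u == v) || e u v -> bd Z \subset [set u; v; w] -> False.
  move=> ZY Z0 u' v' w' u'K v'K w'K uv' bZ; apply: (IH Z u' v' w') => //.
  - by apply: leq_trans (proper_card ZY) _.
  - exact: subset_trans (proper_sub ZY) YK.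
have YW := subset_trans YK KW.
(* If [Y] were the single vertex [z], degree three would make its neighbourhood exactly [u], [v],
   [w] with [u] and [v] adjacent, which gives a triangle. *)
have drop z : z \in Y -> Y :\ z != set0.
  move=> zY; apply/negP => /eqP YE; have zK := subsetP YK z zY.
  have sub : [set t in W | e z t] \subset [set u; v; w].
    apply: subset_trans bY; apply/subsetP => t; rewrite inE => /andP[tW zt].
    apply: (boundaryP tW _ zY zt); apply/negP => tY.
    have : t \in Y :\ z by rewrite in_setD1 tY andbT; apply/eqP => E; rewrite E eI in zt.
    by rewrite YE inE.
  have nuv : u != v.
    apply/eqP => E; have := leq_trans (deg3 (subsetP YW z zY)) (subset_leq_card sub).
    by rewrite E setUid cards2; case: (_ != _).
  have euv : e u v by move: uv; rewrite (negPf nuv).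
  have full : [set t in W | e z t] = [set u; v; w].
    apply/eqP; rewrite eqEcard sub /=; apply: leq_trans (deg3 (subsetP YW z zY)).
    by rewrite -setUA cardsU1 cards2; case: (_ \notin _); case: (_ != _).
  have [uS vS] : u \in [set u; v; w] /\ v \in [set u; v; w] by rewrite !inE !eqxx orbT.
  have zu : e z u by move: uS; rewrite -full inE => /andP[].
  have zv : e z v by move: vS; rewrite -full inE => /andP[].
  exact: (tri z u v).
have shrink z s t : z \in Y -> s \in K -> t \in K -> (s == t) || e s t ->
    bd (Y :\ z) \subset [set s; t; z] -> False.
  move=> zY sK tK st bZ; apply: (min (Y :\ z)) bZ => //; first exact: properD1.
    exact: drop.
  exact: (subsetP YK).
(* If [w] were not a third boundary vertex, any vertex of [Y] could be removed and take its place.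
   The same exchange, of [w] for [a], gives the second neighbour [b] below. *)
have wb : (w \in bd Y) && (w \notin [set u; v]).
  apply/negPn/negP => nw; have /set0Pn[z zY] := Y0.
  apply: (shrink z u v) => //; apply: subset_trans (boundary_remove Y z) _.
  apply/subsetP => t /setU1P[->|tb]; first by rewrite !inE eqxx orbT.
  have := subsetP bY t tb; rewrite !inE => /orP[->//|/eqP tw]; subst t.
  by move: nw; rewrite tb /= !inE negbK => ->.
case/andP: wb => wb; rewrite !inE negb_or => /andP[wu wv].
have [wW wY [a aY aw]] := boundaryE wb.
have [b [bY' bw ab]] : exists b, [/\ b \in Y, e b w & a != b].
  have /exists_inP[b bY' /andP[bw ab]] : [exists b in Y, e b w && (a != b)].
    rewrite -[X in is_true X]negbK negb_exists_in; apply/negP => /forall_inP nb.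
    apply: (shrink a u v) => //; apply/subsetP => t tb.
    have /setU1P[->|tY] := subsetP (boundary_remove Y a) t tb; first by rewrite !inE eqxx orbT.
    have := subsetP bY t tY; rewrite !inE => /orP[->//|/eqP tw]; subst t.
    have [_ _ [x /setD1P[xa xY] xw]] := boundaryE tb.
    by have := nb x xY; rewrite xw eq_sym xa.
  by exists b.
pose H := enum (Y :|: [set u; v]).
have inH x : (x \in H) = [|| x \in Y, x == u | x == v] by rewrite mem_enum !inE.
have HK x : x \in H -> x \in K by rewrite inH => /or3P[/(subsetP YK)|/eqP->|/eqP->].
have wH : w \notin H by rewrite inH (negPf wY) (negPf wu) (negPf wv).
have aH : a \in H by rewrite inH aY.
have bH : b \in H by rewrite inH bY'.
have triH x z t : x \in w :: H -> z \in w :: H -> t \in w :: H -> e x z -> e z t -> e x t -> False.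
  have wHK y : y \in w :: H -> y \in K by rewrite inE => /orP[/eqP->|/HK].
  by move=> /wHK xK /wHK zK /wHK tK; apply: tri.
have cut := no_cut min YW KW YK uK vK wK uv bY.
have nocut c : c \in H -> c != a -> c != b -> connect (avoid e H c c) a b.
  move=> cH ca cb; apply: cut; rewrite ?eqxx ?aY ?bY' ?HK //; by rewrite eq_sym.
have inHw x : x \in H -> x != w by apply: contraTneq => ->.
(* As [w] is not in [H], deleting it changes nothing: this connects [a] and [b] in [H] itself. *)
have /connectP[l0 pl0 lb0] : connect (avoid e H w w) a b.
  by apply: cut; rewrite ?eqxx ?aY ?bY' ?inHw.
case/shortenP: pl0 lb0 => l pl ul _ lb.
have [{}pl lH] := avoid_path pl.
have alH : {subset a :: l <= H} by move=> x; rewrite inE => /orP[/eqP->|/lH[]].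
have [t [s [[pt ps ut us ts] [tH sH]]]] :=
  no_cutvertex_two_paths eS pl (esym lb) ul alH ab nocut.
have [at' bt] : a \notin t /\ b \notin t.
  by move: ut; rewrite /= mem_rcons inE negb_or rcons_uniq => /andP[/andP[_ ->] /andP[->]].
have [as' bs] : a \notin s /\ b \notin s.
  by move: us; rewrite /= mem_rcons inE negb_or rcons_uniq => /andP[/andP[_ ->] /andP[->]].
have wa : e w a by rewrite eS.
have wb' : e w b by rewrite eS.
have C : nbr_cycle e w H a b t s by constructor.
have [a' [b' [c [d [[aH' bH' _ _] [cH dH cd] [ac ad bc bd'] /negP]]]]] :=
  separating_edge eS eI free wH triH C (ltnSn _).
apply; apply: cut; rewrite ?cd ?orbT ?HK //; rewrite cH dH andbT andbT orbC.
by apply/orP; left; apply/eqP => E; rewrite E eI in cd.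
Qed.

(** A triangle in [X] plus its boundary has at most one corner outside a minimal [X], so
    [no_triangle] excludes it. Then [u], [v], [w] may all be the boundary vertex, or any vertex of
    [X] if there is none. *)
Lemma no_fragment1 n (X : {set V}) :
  #|X| < n -> X \subset W -> X != set0 -> #|bd X| <= 1 -> False.
Proof.
elim: n X => // n IH X Xn XW X0 bX.
have min (Y : {set V}) : Y \proper X -> Y != set0 -> #|bd Y| <= 1 -> False.
  move=> YX; apply: IH; first exact: leq_trans (proper_card YX) _.
  exact: subset_trans (proper_sub YX) XW.
pose K := X :|: bd X.
have KW : K \subset W by apply/subsetP => x; rewrite inE => /orP[/(subsetP XW)//|/boundaryE[]].
have tri x z t : x \in K -> z \in K -> t \in K -> e x z -> e z t -> e x t -> False.
  have XorB y : y \in K -> (y \in X) \/ (y \in bd X) by rewrite inE => /orP.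
  have eqB y y' : y \in bd X -> y' \in bd X -> e y y' -> False.
    by move=> yB yB'; rewrite ((card_le1_eqP bX) y y' yB yB') eI.
  move=> xK zK tK xz zt xt; have zx : e z x by rewrite eS. have tz : e t z by rewrite eS.
  have tx : e t x by rewrite eS.
  have kW := subsetP KW.
  case: (XorB x xK) => xX; case: (XorB z zK) => zX; case: (XorB t tK) => tX;
    try by [case: (eqB x z) | case: (eqB x t) | case: (eqB z t)].
  - exact: (no_triangle min XW bX (kW x xK) zX tX).
  - exact: (no_triangle min XW bX (kW t tK) xX zX).
  - exact: (no_triangle min XW bX (kW z zK) xX tX).
  - exact: (no_triangle min XW bX (kW x xK) zX tX).
have XK : X \subset K by apply: subsetUl.
have [c cK cB] : exists2 c, c \in K & bd X \subset [set c].
  case: (set_0Vmem (bd X)) => [->|[c cX]].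
    by have /set0Pn[x xX] := X0; exists x; [apply: (subsetP XK) | apply: sub0set].
  exists c; first by rewrite inE cX orbT.
  by apply/subsetP => z zX; rewrite inE; apply/eqP; apply: (card_le1_eqP bX).
apply: (@no_fragment n.+1 K X c c c tri KW Xn XK X0 cK cK cK); rewrite ?eqxx //.
by rewrite !setUid.
Qed.

End LowDegree.

(** * The degree bound and the coloring *)

(** Degrees are counted inside an arbitrary [W] because the coloring deletes vertices one by one.
    The set [W] has empty boundary relative to itself, so [no_fragment1] applies to it. *)
Lemma low_degree_vertex (V : finType) (e : rel V) (W : {set V}) :
  symmetric e -> irreflexive e -> ~ has_induced_propeller e -> W != set0 ->
  exists2 v, v \in W & #|[set w in W | e v w]| <= 2.
Proof.
move=> eS eI free W0; apply/exists_inP.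
rewrite -[X in is_true X]negbK negb_exists_in; apply/negP => /forall_inP deg.
have deg3 v : v \in W -> 2 < #|[set w in W | e v w]| by move=> vW; rewrite ltnNge deg.
apply: (no_fragment1 eS eI free deg3 (ltnSn #|W|)) => //.
suff -> : boundary e W W = set0 by rewrite cards0.
by apply/setP => z; rewrite !inE; case: (z \in W).
Qed.

Lemma greedy_coloring (V : finType) (e : rel V) : symmetric e -> irreflexive e ->
  (forall W : {set V}, W != set0 -> exists2 v, v \in W & #|[set w in W | e v w]| <= 2) ->
  forall n (W : {set V}), #|W| < n ->
  exists f : V -> 'I_3, {in W &, forall u v, e u v -> f u != f v}.
Proof.
move=> eS eI low; elim=> // n IH W Wn.
case: (eqVneq W set0) => [->|W0]; first by exists (fun=> ord0) => u v; rewrite inE.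
have [v vW dv] := low W W0.
have [|f fP] := IH (W :\ v); first by move: Wn; rewrite (cardsD1 v) vW.
have [c cP] : exists c : 'I_3, c \notin f @: [set w in W | e v w].
  apply/existsP; rewrite -[X in is_true X]negbK negb_exists; apply/negP => /forallP all_c.
  have := leq_trans (leq_imset_card f _) dv; rewrite leqNgt => /negP; apply.
  rewrite -[X in X < _]/2 -{1}(card_ord 3) -cardsT; apply: subset_leq_card.
  by apply/subsetP => c _; have := all_c c; rewrite negbK.
exists (fun w => if w == v then c else f w) => x z xW zW xz.
case: (eqVneq x v) => [xv|xv]; case: (eqVneq z v) => [zv|zv].
- by move: xz; rewrite xv zv eI.
- apply: contraNneq cP => ->; apply: imset_f; by rewrite inE zW -xv.
- rewrite eq_sym; apply: contraNneq cP => ->; apply: imset_f; by rewrite inE xW -zv eS.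
- by apply: fP; rewrite ?in_setD1 ?xv ?zv.
Qed.

Theorem theorem2p11 (V : finType) (e : rel V)
    (e_simple : simple_graph e) (V_nonempty : 0 < #|V|)
    (e_propeller_free : ~ has_induced_propeller e) :
  (exists v : V, degree e v <= 2) /\ colorable 3 e.
Proof.
have [eS eI] := e_simple.
have low := fun W => @low_degree_vertex V e W eS eI e_propeller_free.
split.
  have [|v _ dv] := low setT; first by rewrite -card_gt0 cardsT.
  exists v; apply: leq_trans dv; apply: subset_leq_card.
  by apply/subsetP => w; rewrite !inE.
have [f fP] := greedy_coloring eS eI low (ltnSn #|[set: V]|).
by exists f => u v uv; apply: fP; rewrite ?inE.
Qed.
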